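(* There exists an absolute constant $C>0$ such that the following holds. Let $d,K\in\mathbb{N}$ with $K\ge d$, and let $F$ be a probability distribution on $\mathbb{R}^d$ such that: (1) $F=qI+\sum_{m=1}^K p_mF_m$, where $q,p_1,\dots,p_K\in(0,1)$, $\sum_{m=1}^K p_m=1-q$, and $F_1,\dots,F_K$ are probability distributions on $\mathbb{R}^d$; (2) there exist non-zero vectors $\vec y_1,\dots,\vec y_K\in\mathbb{R}^d$ such that $\operatorname{supp}F_m\subset\{k\vec y_m: k\in\mathbb{Z}\setminus\{0\}\}$ for each $m$, and $\operatorname{supp}F_m\cap\operatorname{supp}F_k=\emptyset$ for $k\neq m$; (3) each $\operatorname{supp}F_m\ne\emptyset$ and $F_m\{k\vec y_m\}=F_m\{-k\vec y_m\}$ for $k\in\{1,2,\dots\}$, $m=1,\dots,K$; (4) for each $m$ there exists an integer $k_m^0$ such that $F_m\{k_m^0\vec y_m\}>0$ and $F_m\{(k_m^0+1)\vec y_m\}>0$. Let $\sigma_m^2=2\sum_{k=1}^\infty k^2F_m\{k\vec y_m\}$. Then, for any $n\in\mathbb{N}$, $$d_{TV}\big(F^{*n},\exp(n(F-I))\big)\leq \frac{C}{n\,q^{7/2}}\left(\sum_{m=1}^K\sqrt{1+\sigma_m}\right)^2.$$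
   Context: $I$ is the distribution concentrated at $\vec 0\in\mathbb{R}^d$; $*$ is convolution of finite signed measures on $\mathbb{R}^d$; $M^{*j}$ is the $j$-fold convolution power, $M^{*0}=I$; $\exp(M)=\sum_{j\ge 0}M^{*j}/j!$. $d_{TV}(F,G)=\sup_B|F\{B\}-G\{B\}|=\frac12\|F-G\|_{TV}$, supremum over Borel sets of $\mathbb{R}^d$. $\sigma_m\ge0$; if some $\sigma_m=\infty$ the right-hand side is understood as $+\infty$. *)

(* Defs.v *)
From HB Require Import structures.
From mathcomp Require Import all_boot all_order all_algebra.
From mathcomp Require Import all_classical all_reals all_analysis.
From mathcomp Require Import lra.

Set Implicit Arguments.
Unset Strict Implicit.
Unset Printing Implicit Defensive.

Import Order.TTheory GRing.Theory Num.Theory.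
Import numFieldNormedType.Exports.

Local Open Scope classical_set_scope.
Local Open Scope ring_scope.
Local Open Scope ereal_scope.

(* Finite signed measures are the charges of the library: countably additive
   set functions that are finite on measurable sets. *)
Section product_charge.
Context (R : realType).

Section finite_product.
Context d1 d2 (T1 : measurableType d1) (T2 : measurableType d2).
Variables (m1 : {finite_measure set T1 -> \bar R})
          (m2 : {finite_measure set T2 -> \bar R}).

Let product_fin_num : fin_num_fun (m1 \x m2).
Proof.
apply: lty_fin_num_fun => /=; rewrite -setXTT product_measure1E//.
by rewrite lte_mul_pinfty// ?fin_num_measure// ltey_eq fin_num_measure.
Qed.

Definition product_finite_charge : set (T1 * T2)%type -> \bar R := m1 \x m2.

HB.instance Definition _ := isCharge.Build _ _ _ product_finite_charge
  (measure0 (m1 \x m2)) product_fin_num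
  (@measure_semi_sigma_additive _ _ _ (m1 \x m2)).

End finite_product.

Section jordan.
Context d (T : measurableType d) (M : {charge set T -> \bar R}).

Definition hahn_sets :
  {PN : set T * set T | hahn_decomposition M PN.1 PN.2}.
Proof.
by apply: cid; have [P [N PN]] := Hahn_decomposition M; exists (P, N).
Qed.

(* The Jordan decomposition M = charge_pos M - charge_neg M. It does not depend
   on the Hahn decomposition that is chosen. *)
Definition charge_pos : {finite_measure set T -> \bar R} :=
  jordan_pos (proj2_sig hahn_sets).

Definition charge_neg : {finite_measure set T -> \bar R} :=
  jordan_neg (proj2_sig hahn_sets).

End jordan.

Definition product_charge d1 d2 (T1 : measurableType d1)
    (T2 : measurableType d2) (M : {charge set T1 -> \bar R})
    (N : {charge set T2 -> \bar R}) : {charge set (T1 * T2)%type -> \bar R} :=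
  cadd (cadd (product_finite_charge (charge_pos M) (charge_pos N))
             (product_finite_charge (charge_neg M) (charge_neg N)))
       (copp (cadd (product_finite_charge (charge_pos M) (charge_neg N))
                   (product_finite_charge (charge_neg M) (charge_pos N)))).

End product_charge.

(* R^d is the space of row vectors, with the sigma-algebra generated by the
   open sets of its usual topology. *)
Section borel_row_vectors.
Context (R : realType) (d : nat).

Definition rV_borel_display : measure_display :=
  sigma_display (@open 'rV[R]_d).

HB.instance Definition _ := @isMeasurable.Build rV_borel_display 'rV[R]_d
  <<s (@open 'rV[R]_d) >> (@sigma_algebra0 _ setT _) (@sigma_algebraC _ _)
  (@sigma_algebra_bigcup _ setT _).

Lemma rV_open_measurable (U : set 'rV[R]_d) : open U -> measurable U.
Proof. exact: sub_sigma_algebra. Qed.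

Definition rV_add (z : 'rV[R]_d * 'rV[R]_d) : 'rV[R]_d := (z.1 + z.2)%R.

Let ratv (p : 'rV[rat]_d) : 'rV[R]_d := map_mx ratr p.

Let rat_approx (x : 'rV[R]_d) (e : R) : (0 < e)%R ->
  exists p : 'rV[rat]_d, ball (ratv p) e x.
Proof.
move=> e0.
have h i : {q : rat | (`|ratr q - x ord0 i| < e)%R}.
  apply: cid; have := @rat_in_itvoo R (x ord0 i - e)%R (x ord0 i + e)%R.
  have -> : (x ord0 i - e < x ord0 i + e)%R by rewrite ltrD2l gtrN.
  move=> /(_ isT)[q]; rewrite in_itv/= => /andP[q1 q2]; exists q.
  by rewrite ltr_norml ltrBrDl q1 ltrBlDl.
exists (\row_i sval (h i))%R; split => // i j.
by rewrite (ord1 i) !mxE /ball/=; exact: (svalP (h j)).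
Qed.

Lemma measurable_rV_add : measurable_fun setT rV_add.
Proof.
apply: (@measurability _ _ _ _ _ _ (@open 'rV[R]_d)) => // _ [U oU <-].
rewrite setTI.
pose box (w : 'rV[rat]_d * 'rV[rat]_d * nat) : set ('rV[R]_d * 'rV[R]_d) :=
  ball (ratv w.1.1) (w.2.+1%:R^-1)%R `*`
  ball (ratv w.1.2) (w.2.+1%:R^-1)%R.
have -> : rV_add @^-1` U =
    \bigcup_(w in [set w | box w `<=` rV_add @^-1` U]) box w.
  apply/seteqP; split => [[x y] /= Uxy|z [w]]; last exact.
  have /nbhs_ballP[e /= e0 eU] := open_nbhs_nbhs (conj oU Uxy).
  have e40 : (0 < e / 4)%R by rewrite divr_gt0.
  have [k _ ke] := near_infty_natSinv_lt (PosNum e40).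
  have {}ke := ke k (leqnn k); rewrite /= in ke.
  have k0 : (0 < k.+1%:R^-1 :> R)%R by rewrite invr_gt0.
  have [p px] := rat_approx x k0.
  have [q qy] := rat_approx y k0.
  exists (p, q, k) => //= -[x' y'] [/= px' qy']; apply: eU.
  have xx' := ball_triangle (ball_sym px) px'.
  have yy' := ball_triangle (ball_sym qy) qy'.
  move: xx' yy'; rewrite -!ball_normE /ball_/= /rV_add/= => xx' yy'.
  have -> : (x + y - (x' + y') = (x - x') + (y - y'))%R.
    by rewrite opprD addrACA.
  rewrite (le_lt_trans (ler_normD _ _))// (lt_le_trans (ltrD xx' yy'))//.
  by move: ke; set r := (k.+1%:R^-1)%R; clearbody r => ?; lra.
rewrite bigcup_mkcond; apply: countable_bigcupT_measurable => // w.
case: ifPn => _; last exact: measurable0.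
by apply: measurableX; apply: rV_open_measurable; exact: ball_open.
Qed.

(* The convolution M * N is the image under addition of the product of the
   signed measures M and N. *)
Definition charge_conv (M N : {charge set 'rV[R]_d -> \bar R}) :
  {charge set 'rV[R]_d -> \bar R}.
Proof.
refine (pushforward (product_charge M N) rV_add).
exact: measurable_rV_add.
Defined.

Definition charge_delta0 : {charge set 'rV[R]_d -> \bar R} :=
  charge_of_finite_measure \d_(0%R : 'rV[R]_d).

Fixpoint charge_conv_pow (M : {charge set 'rV[R]_d -> \bar R}) (j : nat) :
    {charge set 'rV[R]_d -> \bar R} :=
  if j is j'.+1 then charge_conv (charge_conv_pow M j') M else charge_delta0.

(* The series of signed measures converges in total variation, so its sum is
   computed setwise. *)
Definition charge_conv_exp (M : {charge set 'rV[R]_d -> \bar R}) :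
    set 'rV[R]_d -> \bar R :=
  fun B => \sum_(0 <= j <oo) (j`!%:R^-1)%:E * charge_conv_pow M j B.

Definition d_TV (M N : set 'rV[R]_d -> \bar R) : \bar R :=
  ereal_sup [set `|M B - N B| | B in measurable].

(* Topological support. *)
Definition msupp (P : probability 'rV[R]_d R) : set 'rV[R]_d :=
  [set x | forall U, open U -> U x -> 0 < P U].

(* Takes the value +oo when the second moment of P is infinite. *)
Definition lattice_sigma (P : probability 'rV[R]_d R) (y : 'rV[R]_d) : \bar R :=
  sqrte (2%:E * \sum_(1 <= k <oo) ((k%:R ^+ 2)%:E * P [set (k%:R *: y)%R])).

End borel_row_vectors.

(* Main.v *)
Require Import Defs.
From HB Require Import structures.
From mathcomp Require Import all_boot all_order all_algebra.
From mathcomp Require Import all_classical all_reals all_analysis.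
From mathcomp Require Import measurable_realfun.
From mathcomp Require Import ring lra complex.

(* Write F = qI + sum_m p_m F_m as a mixture of symmetric lattice laws.

   Smoothing in one dimension: for the lazy law L = (1 - r) I + r H, with H
   symmetric on the non-zero integers and of variance sigma^2, the total variation
   of (L - I) * L^l is O (sqrt (1 + sigma) / ((1 - r)^(3/2) (l + 1))). Evaluate
   the generating functions at the roots of unity of a large prime order Q.
   Parseval bounds the l2 norms of the coefficients and of their centred first
   moments by averages of 1 / (1 + tau (1 - h (t))), with h the characteristic
   function of H; by convexity of 1 / x these are averages of
   1 / (1 + tau (1 - cos (k t))), and multiplication by k permutes the Q-th roots
   of unity, so that their size does not depend on k.

   Mixtures: as F is sum_m p_m (F_m - I) + I, the product (F - I)^2 * F^k is a
   double sum of terms (F_i - I) * (F_j - I) * F^k. Splitting F as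
   A_i + (A_j + H), where A_m = (q / 2) I + (p_m / 2) F_m, and expanding the power
   binomially gives a smoothing factor to each of the two differences, so the
   norm of (F - I)^2 * F^k is O (W^2 / (q^3 (k + 1) (k + 2))) with
   W = sum_m sqrt (1 + sigma_m). Compare F^n with G^n, G = exp (F - I): the
   difference F - G is (F - I)^2 times a bounded factor, and the n terms of the
   telescoping sum are each O (W^2 / (q^3 n^2)). Finally q^(7/2) <= q^3.

   For finitely supported F_m all of this is algebra in a commutative ring of
   operators on functions that contains the translations; the general case
   follows by truncating the F_m. *)

Set Implicit Arguments.
Unset Strict Implicit.
Unset Printing Implicit Defensive.

Import Order.TTheory GRing.Theory Num.Theory.
Import numFieldNormedType.Exports.

Local Open Scope classical_set_scope.
Local Open Scope ring_scope.

(** * Smoothing for symmetric lattice walks *)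

Section elementary.
Variable R : realType.
Implicit Types (b w u delta : R).

Lemma sum_inv_1Dsqr_le b n : 0 < b ->
  \sum_(j < n) (1 + (j%:R / b) ^+ 2)^-1 <= 1 + 2 * b.
Proof.
move=> b0; case: n => [|n]; first by rewrite big_ord0; lra.
(* The subtracted term makes the induction work: its increments 2 b^2 / ((b + x)(b + x + 1))
   telescope and dominate the summands, because (b + x)(b + x + 1) <= 2 (b^2 + (x + 1)^2). *)
suff : \sum_(j < n.+1) (1 + (j%:R / b) ^+ 2)^-1
    <= 1 + 2 * b - 2 * b ^+ 2 / (b + n%:R).
  move/le_trans; apply; rewrite gerBl; apply: divr_ge0.
    by rewrite mulr_ge0// sqr_ge0.
  by rewrite addr_ge0// ltW.
elim: n => [|n IH].
  rewrite big_ord_recr big_ord0/= mul0r expr0n/= !add0r addr0 invr1 addr0.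
  by rewrite le_eqVlt; apply/orP; left; apply/eqP; field; rewrite gt_eqF.
rewrite big_ord_recr/= (le_trans (lerD IH (lexx _)))//.
have n0 : 0 <= n%:R :> R by [].
rewrite -(natr1 n); move: n0; set x : R := n%:R; move=> x0.
have -> : (1 + ((x + 1) / b) ^+ 2)^-1 = b ^+ 2 / (b ^+ 2 + (x + 1) ^+ 2).
  have c0 : 0 < b ^+ 2 + (x + 1) ^+ 2 by rewrite addr_gt0// exprn_gt0//; lra.
  by field;  rewrite !gt_eqF.
rewrite -lerBrDl.
have -> : 1 + 2 * b - 2 * b ^+ 2 / (b + (x + 1)) -
   (1 + 2 * b - 2 * b ^+ 2 / (b + x)) = 2 * b ^+ 2 / ((b + x) * (b + x + 1)).
  by field; rewrite !gt_eqF//; lra.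
rewrite ler_pdivrMr; last by rewrite addr_gt0// exprn_gt0//; lra.
rewrite mulrAC ler_pdivlMr; last by rewrite mulr_gt0//; lra.
rewrite [leLHS]mulrC [leRHS]mulrC.
rewrite -subr_ge0.
have -> : (b ^+ 2 + (x + 1) ^+ 2) * (2 * b ^+ 2) - (b + x) * (b + x + 1) * b ^+ 2 = b ^+ 2 * (2 * (b ^+ 2 + (x + 1) ^+ 2) - (b + x) * (b + x + 1)) by ring.
rewrite mulr_ge0 ?sqr_ge0//.
have : 0 <= (b - x - 1 / 2) ^+ 2 by exact: sqr_ge0.
by rewrite !expr2; lra.
Qed.

Lemma bernoulli_ge x l : 0 <= x -> 1 + l%:R * x <= (1 + x) ^+ l :> R.
Proof.
move=> x0; elim: l => [|l IH]; first by rewrite mul0r addr0 expr0.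
rewrite exprS (le_trans _ (ler_wpM2l _ IH))//; last lra.
rewrite -(natr1 l); have : 0 <= l%:R * x * x by rewrite !mulr_ge0.
lra.
Qed.

(** Since (1 - w)(1 + w/2)^2 <= 1, the power is at most (1 + w/2)^(-2l). By Bernoulli, (1 + w/2)^l
    >= 1 + l w/2, and three times this is at least 1 + (l + 1) w because w <= 1; squaring gives the
    9. *)
Lemma exprn_1B_le w l : 0 <= w <= 1 -> (1 - w) ^+ l <= 9 / (1 + l.+1%:R * w) ^+ 2.
Proof.
move=> /andP[w0 w1].
have l0 : 0 <= l%:R :> R by [].
have lw0 : 0 <= l%:R * w by rewrite mulr_ge0.
have lS : l.+1%:R * w = l%:R * w + w by rewrite -(natr1 l) mulrDl mul1r.
have h1 : (1 - w) ^+ l * ((1 + w / 2) ^+ l) ^+ 2 <= 1.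
  rewrite exprAC -exprMn exprn_ile1//.
    by rewrite mulr_ge0 ?sqr_ge0// subr_ge0.
  have : 0 <= w ^+ 2 * (3 / 4 + w / 4) by rewrite mulr_ge0 ?sqr_ge0//; lra.
  by rewrite !expr2; lra.
have w20 : 0 <= w / 2 by lra.
have h2 := bernoulli_ge l w20.
have h3 : 0 < (1 + l.+1%:R * w) ^+ 2 by rewrite exprn_gt0// lS; lra.
rewrite ler_pdivlMr//.
apply: (@le_trans _ _ (9 * ((1 - w) ^+ l * ((1 + w / 2) ^+ l) ^+ 2))); last lra.
rewrite [leRHS]mulrCA ler_wpM2l ?exprn_ge0 ?subr_ge0//.
have -> : 9 * ((1 + w / 2) ^+ l) ^+ 2 = (3 * (1 + w / 2) ^+ l) ^+ 2 by rewrite exprMn; congr (_ * _); lra.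
rewrite lerXn2r// ?nnegrE; lra.
Qed.

(** In the application 1 - u is the characteristic function of a lazy law: its atom [delta] at 0
    keeps that function above 2 delta - 1, hence away from -1. *)
Lemma norm_1B_le u delta : 0 < delta <= 1 -> 0 <= u <= 2 * (1 - delta) ->
  `|1 - u| <= 1 - delta * u.
Proof.
move=> /andP[d0 d1] /andP[u0 u1]; rewrite ler_norml; apply/andP; split.
  have : (1 + delta) * u <= (1 + delta) * (2 * (1 - delta)).
    by rewrite ler_wpM2l//; lra.
  have : 0 <= delta ^+ 2 by exact: sqr_ge0.
  rewrite expr2; lra.
have : 0 <= (1 - delta) * u by rewrite mulr_ge0//; lra.
lra.
Qed.

Lemma delta_u_le1 u delta : 0 < delta <= 1 -> 0 <= u <= 2 * (1 - delta) ->
  0 <= delta * u <= 1.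
Proof.
move=> d01 u01; have := norm_1B_le d01 u01; have := normr_ge0 (1 - u).
move: d01 u01 => /andP[d0 d1] /andP[u0 u1] ? ?.
by rewrite mulr_ge0//=; lra.
Qed.

Lemma power_decay u delta l : 0 < delta <= 1 -> 0 <= u <= 2 * (1 - delta) ->
  `|1 - u| ^+ l <= 9 / (1 + l.+1%:R * delta * u) ^+ 2.
Proof.
move=> d01 u01.
have := exprn_1B_le l (delta_u_le1 d01 u01).
rewrite mulrA; apply: le_trans.
by rewrite lerXn2r ?nnegrE// ?norm_1B_le// (le_trans _ (norm_1B_le d01 u01)).
Qed.

(** Bounds the squared transform of (L - I) * L^l at one frequency. With t = (l + 1) delta, three of
    the four factors 1 + t u in the denominator absorb (t u)^2; the fourth is kept, because its
    average over the frequencies is small. *)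
Lemma smooth_bound0 u delta l : 0 < delta <= 1 -> 0 <= u <= 2 * (1 - delta) ->
  (u * `|1 - u| ^+ l) ^+ 2 <=
  81 / (l.+1%:R * delta) ^+ 2 / (1 + l.+1%:R * delta * u).
Proof.
move=> d01 u01.
have := power_decay l d01 u01; move: d01 u01 => /andP[d0 d1] /andP[u0 u1].
have t0 : 0 < l.+1%:R * delta by rewrite mulr_gt0.
move: t0; set t := l.+1%:R * delta => t0 h.
have tu0 : 0 <= t * u by rewrite mulr_ge0// ltW.
have c0 : 0 < 1 + t * u by lra.
rewrite exprMn; apply: (@le_trans _ _ (u ^+ 2 * (9 / (1 + t * u) ^+ 2) ^+ 2)).
  rewrite ler_wpM2l ?sqr_ge0// lerXn2r// ?nnegrE ?exprn_ge0//.
  by rewrite divr_ge0// sqr_ge0.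
rewrite ler_pdivlMr// ler_pdivlMr ?exprn_gt0//.
have -> : u ^+ 2 * (9 / (1 + t * u) ^+ 2) ^+ 2 * (1 + t * u) * t ^+ 2 =
  81 * (t * u) ^+ 2 / (1 + t * u) ^+ 3.
  by field; rewrite gt_eqF.
rewrite ler_pdivrMr ?exprn_gt0//.
move: (t * u) tu0 => z z0.
rewrite ler_pM2l//.
have z2 : 0 <= z * z by rewrite mulr_ge0.
have z3 : 0 <= z * z * z by rewrite mulr_ge0.
have -> : (1 + z) ^+ 3 = 1 + 3 * z + 3 * (z * z) + z * z * z by ring.
rewrite expr2; lra.
Qed.

(** The counterpart for the centred derivative: the leading [u] comes from the derivative of the
    characteristic function, the bracket from the product rule. Here 2025 = (9 + 36)^2. *)
Lemma smooth_bound1 u delta l : 0 < delta <= 1 -> 0 <= u <= 2 * (1 - delta) ->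
  u * (`|1 - u| ^+ l + l%:R * u * `|1 - u| ^+ l.-1) ^+ 2 <=
  2025 / (delta ^+ 2 * (l.+1%:R * delta)) / (1 + l.+1%:R * delta * u).
Proof.
move=> d01 u01.
have h := power_decay l d01 u01.
have h' := power_decay l.-1 d01 u01; move: (delta_u_le1 d01 u01) (d01) (u01) => /andP[w0 w1] /andP[d0 d1] /andP[u0 u1].
have t0 : 0 < l.+1%:R * delta by rewrite mulr_gt0.
move: t0 h; set t := l.+1%:R * delta => t0 h.
have tu0 : 0 <= t * u by rewrite mulr_ge0// ltW.
have c0 : 0 < 1 + t * u by lra.
have h2 : `|1 - u| ^+ l + l%:R * u * `|1 - u| ^+ l.-1 <= 45 / delta / (1 + t * u).
  have e1 : `|1 - u| ^+ l <= 9 / delta / (1 + t * u).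
    rewrite (le_trans h)// ler_pdivrMr ?exprn_gt0//.
    have -> : 9 / delta / (1 + t * u) * (1 + t * u) ^+ 2 = 9 * (1 + t * u) / delta.
      by field; rewrite !gt_eqF.
    rewrite ler_pdivlMr// ler_wpM2l//; lra.
  suff e2 : l%:R * u * `|1 - u| ^+ l.-1 <= 36 / delta / (1 + t * u).
    by rewrite (le_trans (lerD e1 e2))// -!mulrDl ler_pM2r ?invr_gt0// ler_pM2r ?invr_gt0//; lra.
  case: l h' @t t0 tu0 c0 {h e1} => [|l] h' t t0 tu0 c0.
    by rewrite !mul0r divr_ge0 ?divr_ge0// ltW.
  (* The power is one lower than [t] accounts for. This costs at most a factor 2, hence 36 = 9 *
     4. *)
  have c1 : 1 + t * u <= 2 * (1 + l.+1%:R * delta * u).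
    rewrite /t -(natr1 l.+1); have : 0 <= l.+1%:R * delta * u by rewrite -mulrA mulr_ge0.
    lra.
  apply: (@le_trans _ _ (l.+1%:R * u * (9 / ((1 + t * u) / 2) ^+ 2))).
    rewrite ler_wpM2l ?mulr_ge0// (le_trans h')// ler_pM2l//= lef_pV2.
    - rewrite lerXn2r ?nnegrE//; lra.
    - rewrite posrE exprn_gt0//; lra.
    - rewrite posrE exprn_gt0//; lra.
  have -> : l.+1%:R * u * (9 / ((1 + t * u) / 2) ^+ 2) =
     36 / delta / (1 + t * u) * (l.+1%:R * delta * u / (1 + t * u)).
    by field; rewrite !gt_eqF.
  rewrite ler_piMr ?divr_ge0//; [lra|lra|].
  rewrite ler_pdivrMr// mul1r /t -(natr1 l.+1); lra.
apply: (@le_trans _ _ (u * (45 / delta / (1 + t * u)) ^+ 2)).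
  rewrite ler_wpM2l// lerXn2r// nnegrE.
    by rewrite addr_ge0 ?mulr_ge0 ?exprn_ge0.
  by rewrite !divr_ge0// ltW.
have -> : u * (45 / delta / (1 + t * u)) ^+ 2 =
  2025 / (delta ^+ 2 * t) / (1 + t * u) * (t * u / (1 + t * u)).
  by field; rewrite !gt_eqF.
have : 0 <= 2025 :> R by rewrite ler0n.
move: (2025 : R) => c c2025; apply: ler_piMr; last first.
  by rewrite ler_pdivrMr//; lra.
apply: divr_ge0; last exact: ltW.
by apply: divr_ge0 => //; rewrite mulr_ge0 ?sqr_ge0// ltW.
Qed.

End elementary.

(** * Trigonometric sums over roots of unity and Parseval's identity *)

Section trigonometry.
Variable R : realType.
Implicit Types (t lambda : R) (Q : nat).

Lemma cos_piquarter_ge : 1 / 2 <= cos (pi / 4) :> R.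
Proof.
have : cos (pi / 4 : R) ^+ 2 = 1 / 2.
  have := cos_mulr2n (pi / 4 : R).
  have -> : (pi / 4) *+ 2 = pi / 2 :> R by rewrite mulr2n; lra.
  rewrite cos_pihalf; lra.
have : 0 <= cos (pi / 4 : R).
  by apply: cos_ge0_pihalf; have := pi_ge0 R; lra.
move: (cos _) => c c0 c2; rewrite leNgt; apply/negP => c1.
have : c * c < 1 / 2 * (1 / 2) by rewrite ltr_pM.
move: c2; rewrite expr2; lra.
Qed.

(** Up to 1/4 the mean value theorem applies, with slope at least pi cos (pi/4) >= 1; beyond 1/4,
    monotonicity gives sin (pi t) >= sin (pi/4) >= 1/2 >= t. *)
Lemma sin_pi_ge t : 0 <= t <= 1 / 2 -> t <= sin (pi * t).
Proof.
move=> /andP[t0 t1]; have p2 := pi_ge2 R.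
have [t4|t4] := leP t (1 / 4).
  have pt0 : 0 <= pi * t by rewrite mulr_ge0//; lra.
  have dsin x : x \in `]0, pi * t[ -> is_derive x 1 (@sin R) (cos x).
    by move=> _; exact: is_derive_sin.
  have [|c] := MVT_segment pt0 dsin.
    by apply: continuous_subspaceT => x; exact: continuous_sin.
  rewrite in_itv/= sin0 !subr0 => /andP[c0 c1] ->.
  have c4 : c <= pi / 4.
    rewrite (le_trans c1)// (_ : pi / 4 = pi * (1 / 4)); last lra.
    by rewrite ler_wpM2l//; lra.
  have : cos (pi / 4 : R) <= cos c.
    by rewrite leNgt ltr_cos ?in_itv/= -?leNgt//; lra.
  have h4 := cos_piquarter_ge => h.
  have : 1 / 2 * (2 * t) <= cos c * (pi * t).
    by apply: ler_pM => //; [lra|lra|rewrite ler_wpM2r].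
  lra.
have : sin (pi / 4 : R) <= sin (pi * t).
  have : pi * (1 / 4) <= pi * t by rewrite ler_wpM2l//; lra.
  have : pi * t <= pi * (1 / 2) by rewrite ler_wpM2l//; lra.
  move=> a b.
  by rewrite leNgt ltr_sin ?in_itv/= -?leNgt//; lra.
have -> : sin (pi / 4 : R) = cos (pi / 4).
  by rewrite -cosBpihalf -cosN; congr cos; lra.
have := cos_piquarter_ge; lra.
Qed.

Definition root_angle Q : R := pi *+ 2 / Q%:R.

Lemma sub1_cos_root_angle Q j :
  1 - cos (j%:R * root_angle Q) = 2 * sin (pi * (j%:R / Q%:R)) ^+ 2.
Proof.
have -> : j%:R * root_angle Q = (pi * (j%:R / Q%:R)) *+ 2 :> R.
  by rewrite /root_angle !mulr2n; ring.
rewrite cos_mulr2n cos2sin2; lra.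
Qed.

(** Quadratic growth in the distance of j to the nearer of 0 and Q; the symmetry sin (pi - x) = sin
    x exchanges the two cases. *)
Lemma sub1_cos_root_angle_ge Q j : (j <= Q)%N -> (0 < Q)%N ->
  2 * (j%:R / Q%:R) ^+ 2 <= 1 - cos (j%:R * root_angle Q) \/
  2 * ((Q - j)%:R / Q%:R) ^+ 2 <= 1 - cos (j%:R * root_angle Q).
Proof.
move=> jQ Q0; have Q0' : 0 < Q%:R :> R by rewrite ltr0n.
rewrite sub1_cos_root_angle.
have t0 : 0 <= j%:R / Q%:R :> R by rewrite divr_ge0.
have [t1|t1] := leP (j%:R / Q%:R) (1 / 2 : R); [left|right].
  rewrite ler_wpM2l// lerXn2r ?nnegrE//; last by rewrite sin_pi_ge// t0.
  by rewrite (le_trans t0)// sin_pi_ge// t0.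
have -> : sin (pi * (j%:R / Q%:R)) = sin (pi * ((Q - j)%:R / Q%:R)) :> R.
  have -> : pi * ((Q - j)%:R / Q%:R) = - (pi * (j%:R / Q%:R)) + pi :> R.
    by rewrite natrB//; field; rewrite gt_eqF.
  by rewrite sinDpi sinN opprK.
have t2 : (Q - j)%:R / Q%:R <= 1 / 2 :> R.
  have -> : (Q - j)%:R / Q%:R = 1 - j%:R / Q%:R :> R.
    by rewrite natrB//; field; rewrite gt_eqF.
  lra.
have t3 : 0 <= (Q - j)%:R / Q%:R :> R by rewrite divr_ge0.
rewrite ler_wpM2l// lerXn2r ?nnegrE//; last by rewrite sin_pi_ge// t3.
by rewrite (le_trans t3)// sin_pi_ge// t3.
Qed.

Lemma sum_inv_1Dcos_le Q lambda : (0 < Q)%N -> 0 < lambda ->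
  \sum_(j < Q) (1 + lambda * (1 - cos (j%:R * root_angle Q)))^-1 <=
  2 * (1 + 2 * (Q%:R / Num.sqrt (2 * lambda))).
Proof.
move=> Q0 l0; set b := _ / Num.sqrt _.
have Q0' : 0 < Q%:R :> R by rewrite ltr0n.
have s0 : 0 < Num.sqrt (2 * lambda) by rewrite sqrtr_gt0 mulr_gt0.
have b0 : 0 < b by rewrite divr_gt0.
pose h k : R := (1 + (k%:R / b) ^+ 2)^-1.
have h0 k : 0 <= h k by rewrite invr_ge0 addr_ge0// sqr_ge0.
have hE k : (1 + lambda * (2 * (k%:R / Q%:R) ^+ 2))^-1 = h k.
  rewrite /h; congr (1 + _)^-1.
  have -> : k%:R / b = k%:R / Q%:R * Num.sqrt (2 * lambda).
    by rewrite /b; field; rewrite !gt_eqF.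
  rewrite [in RHS]exprMn sqr_sqrtr ?mulr_ge0//; last exact: ltW.
  by ring.
(* Adding the terms of both distances makes the bound uniform in j, at the price of a factor 2 in
   the sum. *)
have hle (j : 'I_Q) : (1 + lambda * (1 - cos (j%:R * root_angle Q)))^-1 <= h j + h (Q - j)%N.
  have key k : 2 * (k%:R / Q%:R) ^+ 2 <= 1 - cos (j%:R * root_angle Q) ->
      (1 + lambda * (1 - cos (j%:R * root_angle Q)))^-1 <= h k.
    move=> hk; have c0 : 0 <= lambda * (2 * (k%:R / Q%:R) ^+ 2).
      by rewrite !mulr_ge0 ?sqr_ge0// ltW.
    have c1 : lambda * (2 * (k%:R / Q%:R) ^+ 2) <= lambda * (1 - cos (j%:R * root_angle Q)).
      by rewrite ler_pM2l.
    rewrite -hE lef_pV2 ?posrE; lra.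
  have [/key|/key] := sub1_cos_root_angle_ge (ltnW (ltn_ord j)) Q0.
    by move/le_trans; apply; rewrite lerDl.
  by move/le_trans; apply; rewrite lerDr.
apply: le_trans (ler_sum _ (fun j _ => hle j)) _.
rewrite big_split/= mulrDl !mul1r; apply: lerD; first exact: sum_inv_1Dsqr_le.
rewrite (reindex_inj rev_ord_inj)/=.
apply: (@le_trans _ _ (\sum_(j < Q.+1) h j)); last exact: sum_inv_1Dsqr_le.
rewrite big_ord_recl/= (le_trans _ (_ : \sum_(i < Q) h (bump 0 i) <= _))//; last by rewrite lerDr.
apply: ler_sum => j _; rewrite /bump/= add1n subKn//.
Qed.

Lemma cos_modn_root_angle Q k : (0 < Q)%N ->
  cos ((k %% Q)%:R * root_angle Q) = cos (k%:R * root_angle Q).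
Proof.
move=> Q0; rewrite [in RHS](divn_eq k Q) natrD mulrDl addrC natrM -mulrA.
have -> : Q%:R * root_angle Q = pi *+ 2 by rewrite /root_angle mulrC divfK// pnatr_eq0 -lt0n.
by rewrite (mulr_natl (pi *+ 2)) (periodicn (@cosD2pi R)).
Qed.

(** Modulo a prime, k is invertible, so multiplication by it permutes the residues. *)
Lemma sum_mul_modn_prime Q k (g : nat -> R) : prime Q -> (0 < k < Q)%N ->
  \sum_(j < Q) g ((k * j) %% Q)%N = \sum_(j < Q) g j.
Proof.
move=> pQ /andP[k0 kQ]; have Q0 := prime_gt0 pQ.
pose f (j : 'I_Q) : 'I_Q := Ordinal (ltn_pmod (k * j) Q0).
have finj : injective f.
  move=> i j /(congr1 val)/= /eqP.
  wlog ij : i j / (i <= j)%N.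
    by move=> H; case/orP: (leq_total i j) => [/H//|/H h]; rewrite eq_sym => /h ->.
  rewrite eq_sym eqn_mod_dvd ?leq_mul2l ?ij ?orbT// -mulnBr Gauss_dvdr; last first.
    by rewrite prime_coprime//; apply/negP => /(dvdn_leq k0); rewrite leqNgt kQ.
  rewrite /dvdn modn_small; last by rewrite (leq_ltn_trans (leq_subr _ _)).
  by rewrite subn_eq0 => ji; apply/val_inj/eqP; rewrite eqn_leq ij.
by rewrite [RHS](reindex_inj finj).
Qed.

Lemma sum_inv_1Dcos_mul_le Q k lambda : prime Q -> (0 < k < Q)%N -> 0 < lambda ->
  \sum_(j < Q) (1 + lambda * (1 - cos (k%:R * (j%:R * root_angle Q))))^-1 <=
  2 * (1 + 2 * (Q%:R / Num.sqrt (2 * lambda))).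
Proof.
move=> pQ kQ l0; have Q0 := prime_gt0 pQ.
rewrite (le_trans _ (sum_inv_1Dcos_le Q0 l0))//.
rewrite -(sum_mul_modn_prime (fun j => (1 + lambda * (1 - cos (j%:R * root_angle Q)))^-1) pQ kQ).
by rewrite le_eqVlt; apply/orP; left; apply/eqP; apply: eq_bigr => j _; rewrite cos_modn_root_angle// natrM mulrA.
Qed.

Local Open Scope complex_scope.

Definition expi t : R[i] := cos t +i* sin t.

Lemma expiD t s : expi (t + s) = expi t * expi s.
Proof. by rewrite /expi cosD sinD; congr (_ +i* _); rewrite addrC [sin _ * _]mulrC. Qed.

Lemma expi0 : expi 0 = 1. Proof. by rewrite /expi cos0 sin0. Qed.

Lemma expiX t n : expi t ^+ n = expi (n%:R * t).
Proof.
elim: n => [|n IH]; first by rewrite mul0r expi0.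
by rewrite exprS IH -expiD -natr1 mulrDl mul1r addrC.
Qed.

(** Real-valued, whereas the norm of [R[i]] takes its values in [R[i]]. *)
Definition sqnorm (z : R[i]) : R := complex.Re z ^+ 2 + complex.Im z ^+ 2.

Lemma sqnormM z w : sqnorm (z * w) = sqnorm z * sqnorm w.
Proof. by case: z w => [a b] [c d]; rewrite /sqnorm/=; ring. Qed.

Lemma sqnorm_expi t : sqnorm (expi t) = 1.
Proof. by rewrite /sqnorm/= cos2Dsin2. Qed.

Lemma sqnormX z n : sqnorm (z ^+ n) = sqnorm z ^+ n.
Proof.
elim: n => [|n IH]; first by rewrite /sqnorm/= expr1n expr0n/= addr0.
by rewrite !exprS sqnormM IH.
Qed.

Lemma Re_sum n (z : 'I_n -> R[i]) :
  complex.Re (\sum_i z i) = \sum_i complex.Re (z i).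
Proof. by apply: (big_morph _ _ (erefl _)) => -[? ?] [? ?]. Qed.

Lemma Im_sum n (z : 'I_n -> R[i]) :
  complex.Im (\sum_i z i) = \sum_i complex.Im (z i).
Proof. by apply: (big_morph _ _ (erefl _)) => -[? ?] [? ?]. Qed.

(** Real part of a geometric sum with ratio w: w^Q = 1, and w differs from 1 since 1 - Re w = 2
    sin^2 (pi m / Q) > 0. *)
Lemma sum_cos_root_angle Q m : (0 < m < Q)%N ->
  \sum_(j < Q) cos (m%:R * (j%:R * root_angle Q)) = 0.
Proof.
move=> /andP[m0 mQ]; have Q0 := leq_ltn_trans (leq0n _) mQ.
have Q0' : 0 < Q%:R :> R by rewrite ltr0n.
set w := expi (m%:R * root_angle Q).
have wQ : w ^+ Q = 1.
  rewrite /w expiX; have -> : Q%:R * (m%:R * root_angle Q) = 0 + pi *+ 2 *+ m.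
    by rewrite add0r -(mulr_natr (pi *+ 2)) /root_angle; field; rewrite gt_eqF.
  rewrite /expi (periodicn (@cosD2pi R)) (periodicn (@sinD2pi R)).
  by rewrite cos0 sin0.
have w1 : w - 1 != 0.
  rewrite subr_eq0; apply/eqP => /(congr1 (@complex.Re R))/= h.
  have := sub1_cos_root_angle Q m; rewrite h subrr => /esym/eqP.
  rewrite mulf_eq0 pnatr_eq0/= sqrf_eq0 => /eqP s0.
  have : 0 < sin (pi * (m%:R / Q%:R)) :> R.
    apply: sin_gt0_pi; rewrite mulr_gt0 ?pi_gt0 ?divr_gt0 ?ltr0n//=.
    by rewrite gtr_pMr ?pi_gt0// ltr_pdivrMr// mul1r ltr_nat.
  by rewrite s0 ltxx.
have : \sum_(j < Q) w ^+ j = 0.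
  by apply: (mulfI w1); rewrite -subrX1 wQ subrr mulr0.
move/(congr1 (@complex.Re R)); rewrite Re_sum/= => {2}<-.
by apply: eq_bigr => j _; rewrite /w expiX/= mulrCA.
Qed.

Definition fourier (P : {poly R}) t : R[i] := (map_poly (real_complex R) P).[expi t].

Lemma fourierM P P' t : fourier (P * P') t = fourier P t * fourier P' t.
Proof. by rewrite /fourier rmorphM hornerM. Qed.

Lemma fourierD P P' t : fourier (P + P') t = fourier P t + fourier P' t.
Proof. by rewrite /fourier rmorphD hornerD. Qed.

Lemma fourier_sum I (r : seq I) (c : pred I) (F : I -> {poly R}) t :
  fourier (\sum_(i <- r | c i) F i) t = \sum_(i <- r | c i) fourier (F i) t.
Proof. by rewrite /fourier rmorph_sum horner_sum. Qed.

Lemma fourierX P n t : fourier (P ^+ n) t = fourier P t ^+ n.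
Proof. by rewrite /fourier rmorphXn hornerE. Qed.

Lemma fourierZ a P t : fourier (a *: P) t = a%:C * fourier P t.
Proof. by rewrite /fourier map_polyZ hornerZ. Qed.

Lemma fourierXn n t : fourier 'X^n t = expi (n%:R * t).
Proof. by rewrite /fourier map_polyXn hornerXn expiX. Qed.

(** The cross terms carry cosines of frequency |i - k|. As the size is at most Q, this lies strictly
    between 0 and Q for i different from k, and the cosines sum to zero. *)
Lemma parseval (P : {poly R}) Q : (size P <= Q)%N ->
  \sum_(j < Q) sqnorm (fourier P (j%:R * root_angle Q)) = Q%:R * \sum_(i < Q) P`_i ^+ 2.
Proof.
move=> sP.
have E t : sqnorm (fourier P t) = \sum_(i < Q) \sum_(k < Q) P`_i * P`_k * cos (`|i%:R - k%:R| * t).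
  have -> : fourier P t = \sum_(i < Q) (P`_i * cos (i%:R * t)) +i* (P`_i * sin (i%:R * t)).
    have sP' : (size (map_poly (real_complex R) P) <= Q)%N by rewrite size_map_poly.
    rewrite /fourier (horner_coef_wide _ sP').
    by apply: eq_bigr => i _; rewrite coef_map expiX /expi; simpc.
  rewrite /sqnorm Re_sum Im_sum/= !expr2 !big_distrlr/= -big_split/=.
  apply: eq_bigr => i _; rewrite -big_split/=; apply: eq_bigr => k _.
  have -> : cos (`|i%:R - k%:R| * t) = cos (i%:R * t - k%:R * t).
    rewrite -mulrBl; have [h|h] := ger0P (i%:R - k%:R : R) => //.
    by rewrite mulNr cosN.
  by rewrite cosB; ring.
under eq_bigr => j _ do rewrite E.
rewrite exchange_big/= mulr_sumr; apply: eq_bigr => i _.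
rewrite exchange_big/= (bigD1 i)//= [X in _ + X]big1 ?addr0.
  under eq_bigr => j _ do rewrite subrr normr0 mul0r cos0 mulr1.
  by rewrite sumr_const card_ord expr2 mulr_natl.
move=> k ki; rewrite -mulr_sumr.
suff -> : \sum_(j < Q) cos (`|i%:R - k%:R| * (j%:R * root_angle Q)) = 0 by rewrite mulr0.
wlog ik : i k ki / (k < i)%N.
  move=> H; case: (ltngtP k i) => [/H ->//|ik|/val_inj ki']; last first.
    by rewrite ki' eqxx in ki.
  by under eq_bigr => j _ do rewrite distrC; rewrite H// eq_sym.
have -> : `|i%:R - k%:R| = (i - k)%:R :> R.
  by rewrite -natrB 1?ltnW// ger0_norm.
by apply: sum_cos_root_angle; rewrite subn_gt0 ik/= (leq_ltn_trans (leq_subr _ _)).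
Qed.

End trigonometry.

(** * Cauchy-Schwarz and a two-sided weight sum *)

Section cauchy_schwarz.
Variable R : realType.

(** Lagrange's identity: the difference of the two sides is half of a double sum of squares. *)
Lemma cauchy_schwarz_sum (I : finType) (a b : I -> R) :
  (\sum_i a i * b i) ^+ 2 <= (\sum_i a i ^+ 2) * (\sum_i b i ^+ 2).
Proof.
have : 0 <= \sum_i \sum_j (a i * b j - a j * b i) ^+ 2.
  by do 2 (apply: sumr_ge0 => ? _); exact: sqr_ge0.
have -> : \sum_i \sum_j (a i * b j - a j * b i) ^+ 2 =
    2 * ((\sum_i a i ^+ 2) * (\sum_i b i ^+ 2)) - 2 * (\sum_i a i * b i) ^+ 2.
  rewrite expr2 !big_distrlr/= [X in 2 * X - _]exchange_big/=.
  have -> : 2 * (\sum_j \sum_i a i ^+ 2 * b j ^+ 2) =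
      \sum_i \sum_j (a i ^+ 2 * b j ^+ 2 + a j ^+ 2 * b i ^+ 2).
    have -> : \sum_i \sum_j (a i ^+ 2 * b j ^+ 2 + a j ^+ 2 * b i ^+ 2) =
        \sum_i (\sum_j a i ^+ 2 * b j ^+ 2 + \sum_j a j ^+ 2 * b i ^+ 2).
      by apply: eq_bigr => i _; rewrite big_split.
    by rewrite big_split/= [X in _ = X + _]exchange_big/= mulrDl mul1r.
  rewrite mulr_sumr -sumrB; apply: eq_bigr => i _.
  rewrite mulr_sumr -sumrB; apply: eq_bigr => j _.
  by ring.
lra.
Qed.

Lemma sum_inv_1Dsqr_center_le (b : R) c n : 0 < b -> (c <= n)%N ->
  \sum_(i < n) (1 + ((i%:R - c%:R) / b) ^+ 2)^-1 <= 2 * (1 + 2 * b).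
Proof.
move=> b0 cn; rewrite -(big_mkord xpredT (fun i => (1 + ((i%:R - c%:R) / b) ^+ 2)^-1)).
pose h k : R := (1 + (k%:R / b) ^+ 2)^-1.
rewrite (big_cat_nat (leq0n c) cn)/= mulrDl mul1r; apply: lerD.
  rewrite big_nat_rev/= add0n.
  apply: (@le_trans _ _ (\sum_(0 <= i < c.+1) h i)); last first.
    by rewrite big_mkord; exact: sum_inv_1Dsqr_le.
  rewrite [leRHS]big_nat_recl//= -[leLHS]add0r lerD ?invr_ge0 ?addr_ge0 ?sqr_ge0//.
  rewrite big_nat_cond [leRHS]big_nat_cond; apply: ler_sum => i; rewrite andbT => /andP[_ ic].
  by rewrite /h natrB// addrAC subrr sub0r mulNr sqrrN.
rewrite -{1}(add0n c) big_addn.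
rewrite (le_trans _ (sum_inv_1Dsqr_le (n - c) b0))// big_mkord.
by apply: ler_sum => i _; rewrite natrD addrK.
Qed.

End cauchy_schwarz.

(** * The centred derivative of a polynomial *)

Section derivation.
Variable R : realType.
Implicit Types (P : {poly R}) (c : R).

(* Parseval applied to it gives the second moment of the coefficients about c. *)
Definition cderiv c P : {poly R} := 'X * P^`() - c *: P.

Lemma coef_cderiv c P i : (cderiv c P)`_i = (i%:R - c) * P`_i.
Proof.
rewrite /cderiv coefB coefXM coefZ coef_deriv; case: i => [|i]/=.
  by rewrite !sub0r mulNr.
by rewrite mulrBl mulr_natl.
Qed.

(** Formally [cderiv c P] is X^(c+1) (X^(-c) P)', whence a Leibniz rule in which the centres add. *)
Lemma cderivM c c' P P' :
  cderiv (c + c') (P * P') = cderiv c P * P' + P * cderiv c' P'.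
Proof.
by rewrite /cderiv derivM scalerDl -!mul_polyC; ring.
Qed.

Lemma cderivX c P n :
  cderiv (n.+1%:R * c) (P ^+ n.+1) = n.+1%:R *: (P ^+ n * cderiv c P).
Proof.
elim: n => [|n IH]; first by rewrite mul1r expr1 expr0 mul1r scale1r.
rewrite -natr1 mulrDl mul1r exprSr cderivM IH scalerDl scale1r.
by rewrite (exprSr _ n) -scalerAl; congr (_ *: _ + _); ring.
Qed.

Lemma cderivZ c a P : cderiv c (a *: P) = a *: cderiv c P.
Proof. by rewrite /cderiv derivZ -!mul_polyC; ring. Qed.

Lemma cderivD c P P' : cderiv c (P + P') = cderiv c P + cderiv c P'.
Proof. by rewrite /cderiv derivD -!mul_polyC; ring. Qed.

Lemma cderivB c P P' : cderiv c (P - P') = cderiv c P - cderiv c P'.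
Proof. by rewrite /cderiv derivB -!mul_polyC; ring. Qed.

Lemma cderiv_sum c I (r : seq I) (F : I -> {poly R}) :
  cderiv c (\sum_(i <- r) F i) = \sum_(i <- r) cderiv c (F i).
Proof.
apply: (big_morph (cderiv c)) => [P P'|]; first exact: cderivD.
by rewrite /cderiv deriv0 mulr0 scaler0 subr0.
Qed.

Lemma cderivXn c n : cderiv c 'X^n = (n%:R - c) *: 'X^n.
Proof.
apply/polyP => i; rewrite coef_cderiv coefZ coefXn.
by case: eqP => [->//|_]; rewrite !mulr0.
Qed.

End derivation.

(** * The smoothing estimate for one lazy symmetric walk *)

Section lattice_walk.
Variables (R : realType) (N : nat) (f : nat -> R).
Hypothesis f_ge0 : forall k, 0 <= f k.
Hypothesis f_sum : \sum_(k < N) 2 * f k = 1.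

Let sigma2 : R := 2 * \sum_(k < N) k.+1%:R ^+ 2 * f k.

(* The generating function of the law with mass f k at k + 1 and at - (k + 1),
   times X^N to clear the negative exponents. *)
Definition walk_poly : {poly R} :=
  \sum_(k < N) f k *: ('X^(N + k.+1) + 'X^(N - k.+1)).

Definition lazy_poly (r : R) : {poly R} := (1 - r) *: 'X^N + r *: walk_poly.

(** [phi] is 1 minus the characteristic function of the walk, and [psi] is the derivative of
    [phi]. *)
Let phi t : R := \sum_(k < N) 2 * f k * (1 - cos (k.+1%:R * t)).
Let psi t : R := \sum_(k < N) 2 * f k * (k.+1%:R * sin (k.+1%:R * t)).

Local Open Scope complex_scope.

Let fourier_walk t : fourier walk_poly t = expi (N%:R * t) * (1 - phi t)%:C.
Proof.
rewrite /walk_poly fourier_sum.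
have -> : 1 - phi t = \sum_(k < N) 2 * f k * cos (k.+1%:R * t).
  rewrite /phi -[X in X - _ = _]f_sum -sumrB; apply: eq_bigr => k _; ring.
rewrite rmorph_sum mulr_sumr; apply: eq_bigr => k _.
rewrite fourierZ fourierD !fourierXn natrD natrB// mulrDl mulrBl !expiD.
rewrite -mulrDr mulrCA; congr (_ * _).
by rewrite /expi cosN sinN; simpc; congr (_ +i* _); ring.
Qed.

(** Subtracting the centre N leaves the exponents k + 1 and - (k + 1) as opposite weights, so that
    only the sines survive. *)
Let fourier_cderiv_walk t :
  fourier (cderiv N%:R walk_poly) t = expi (N%:R * t) * (0 +i* psi t).
Proof.
rewrite /walk_poly cderiv_sum fourier_sum.
have -> : 0 +i* psi t = \sum_(k < N) (0 +i* (2 * f k * (k.+1%:R * sin (k.+1%:R * t)))).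
  rewrite /psi; apply: (big_morph (fun x : R => 0 +i* x)) => // x y.
  by simpc.
rewrite mulr_sumr; apply: eq_bigr => k _.
rewrite cderivZ cderivD !cderivXn fourierZ fourierD !fourierZ !fourierXn natrD natrB//.
rewrite mulrDl mulrBl !expiD.
rewrite [X in _ * X](_ : _ = expi (N%:R * t) *
   ((k.+1%:R)%:C * expi (k.+1%:R * t) - (k.+1%:R)%:C * expi (- (k.+1%:R * t)))).
  rewrite mulrCA; congr (_ * _).
  by rewrite /expi cosN sinN; simpc; congr (_ +i* _); ring.
have -> : N%:R + k.+1%:R - N%:R = k.+1%:R :> R by ring.
have -> : N%:R - k.+1%:R - N%:R = - k.+1%:R :> R by ring.
by rewrite rmorphN/=; ring.
Qed.

Variables (r : R).
Hypothesis r01 : 0 < r < 1.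
Let delta := 1 - r.
Let u t : R := r * phi t.

Let fourier_lazy t : fourier (lazy_poly r) t = expi (N%:R * t) * (1 - u t)%:C.
Proof.
rewrite /lazy_poly fourierD !fourierZ fourierXn fourier_walk mulrCA [_%:C * _]mulrC -mulrDr.
by congr (_ * _); rewrite -!rmorphM -rmorphD; congr (_%:C); rewrite /u/=; ring.
Qed.

(* Up to the power of X, this is (L - 1) L^l for the lazy law L. *)
Definition smoothed_poly l := r *: (walk_poly - 'X^N) * lazy_poly r ^+ l.

Let fourier_smoothed l t : fourier (smoothed_poly l) t =
  expi (N%:R * t) ^+ l.+1 * (- (u t * (1 - u t) ^+ l))%:C.
Proof.
rewrite /smoothed_poly fourierM fourierX fourier_lazy fourierZ.
have -> : walk_poly - 'X^N = walk_poly + (-1) *: 'X^N by rewrite scaleN1r.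
rewrite fourierD fourierZ fourierXn fourier_walk exprMn exprS.
rewrite /u; move: (expi _) (phi t) => e p.
have CN x : (- x)%:C = - x%:C :> R[i] by rewrite rmorphN.
have CM x y : (x * y)%:C = x%:C * y%:C :> R[i] by rewrite rmorphM.
have CB x y : (x - y)%:C = x%:C - y%:C :> R[i] by rewrite rmorphB.
have CX x : (x ^+ l)%:C = x%:C ^+ l :> R[i] by rewrite rmorphXn.
have C1 : (1 : R)%:C = 1 :> R[i] by [].
by rewrite !(CN, CM, CX) !CB !CM !C1; ring.
Qed.

Let sqnormC (a : R) : sqnorm a%:C = a ^+ 2.
Proof. by rewrite /sqnorm/= expr0n/= addr0. Qed.

Let sqnorm_smoothed l t :
  sqnorm (fourier (smoothed_poly l) t) = (u t * `|1 - u t| ^+ l) ^+ 2.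
Proof.
rewrite fourier_smoothed sqnormM sqnormX sqnorm_expi expr1n mul1r sqnormC.
by rewrite sqrrN !exprMn -!exprM mulnC !exprM real_normK ?num_real.
Qed.

(** The derivative centred at N kills ['X^N], so [lazy_poly r] and [r *: (walk_poly - 'X^N)] have
    the same centred derivative. For l = 0 the second summand has coefficient 0, consistently with
    the convention [0.-1 = 0]. *)
Let cderiv_smoothed l : cderiv (l.+1%:R * N%:R) (smoothed_poly l) =
  r *: cderiv N%:R walk_poly * (lazy_poly r ^+ l +
    l%:R *: (r *: (walk_poly - 'X^N)) * lazy_poly r ^+ l.-1).
Proof.
have dl : cderiv N%:R (lazy_poly r) = r *: cderiv N%:R walk_poly.
  by rewrite /lazy_poly cderivD !cderivZ cderivXn subrr scale0r scaler0 add0r.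
have dw : cderiv N%:R (r *: (walk_poly - 'X^N)) = r *: cderiv N%:R walk_poly.
  by rewrite cderivZ cderivB cderivXn subrr scale0r subr0.
rewrite /smoothed_poly; case: l => [|l].
  by rewrite mul1r !expr0 !mulr1 scale0r addr0 mulr1 dw.
rewrite -natr1 mulrDl mul1r addrC cderivM cderivX dw dl/=.
by rewrite -!mul_polyC; ring.
Qed.

Let sqnorm_cderiv_smoothed l t :
  sqnorm (fourier (cderiv (l.+1%:R * N%:R) (smoothed_poly l)) t) =
  (r * psi t) ^+ 2 * ((1 - u t) ^+ l - l%:R * u t * (1 - u t) ^+ l.-1) ^+ 2.
Proof.
rewrite cderiv_smoothed fourierM sqnormM; congr (_ * _).
  rewrite fourierZ fourier_cderiv_walk !sqnormM sqnorm_expi mul1r sqnormC.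
  by rewrite exprMn; congr (_ * _); rewrite /sqnorm/= expr0n/= add0r.
rewrite fourierD -scalerAl fourierZ fourierX fourier_lazy.
have -> : r *: (walk_poly - 'X^N) * lazy_poly r ^+ l.-1 = smoothed_poly l.-1 by [].
rewrite fourier_smoothed.
case: l => [|l]/=.
  by rewrite !expr0 !mul0r addr0 subr0 expr1n /sqnorm/= expr1n expr0n addr0.
rewrite exprMn mulrCA -mulrDr sqnormM sqnormX sqnorm_expi expr1n mul1r.
by rewrite -rmorphXn/= -rmorphM -rmorphD/= sqnormC mulrN mulrA.
Qed.

Let phi_ge0 t : 0 <= phi t.
Proof.
by apply: sumr_ge0 => k _; rewrite !mulr_ge0// subr_ge0 cos_le1.
Qed.

Let phi_le2 t : phi t <= 2.
Proof.
have -> : 2 = \sum_(k < N) 2 * f k * 2 by rewrite -mulr_suml f_sum mul1r.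
apply: ler_sum => k _; rewrite ler_wpM2l ?mulr_ge0//.
by have := cos_geN1 (k.+1%:R * t); lra.
Qed.

(** Cauchy-Schwarz for the weights 2 f, then sin^2 <= 2 (1 - cos). The factor [phi] gained here
    supplies the leading [u] of [smooth_bound1]. *)
Let psi_le t : psi t ^+ 2 <= sigma2 * (2 * phi t).
Proof.
pose a (k : 'I_N) := Num.sqrt (2 * f k) * k.+1%:R.
pose b (k : 'I_N) := Num.sqrt (2 * f k) * sin (k.+1%:R * t).
have sq (k : 'I_N) : Num.sqrt (2 * f k) ^+ 2 = 2 * f k by rewrite sqr_sqrtr// mulr_ge0.
have := cauchy_schwarz_sum a b.
have -> : \sum_i a i * b i = psi t.
  by apply: eq_bigr => k _; rewrite /a /b mulrACA -expr2 sq.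
have -> : \sum_i a i ^+ 2 = sigma2.
  by rewrite /sigma2 mulr_sumr; apply: eq_bigr => k _; rewrite /a exprMn sq; ring.
move/le_trans; apply; apply: ler_wpM2l.
  by rewrite mulr_ge0// sumr_ge0// => k _; rewrite mulr_ge0// sqr_ge0.
rewrite mulr_sumr; apply: ler_sum => k _; rewrite /b exprMn sq [leRHS]mulrCA.
rewrite ler_wpM2l ?mulr_ge0// sin2cos2.
have := cos_le1 (k.+1%:R * t); have := sqr_ge0 (1 - cos (k.+1%:R * t)).
by move: (cos _) => c; rewrite !expr2; lra.
Qed.

Let r0 : 0 < r. Proof. by case/andP: r01. Qed.
Let d0 : 0 < delta. Proof. by rewrite subr_gt0; case/andP: r01. Qed.
Let d01 : 0 < delta <= 1.
Proof. by rewrite d0/= /delta; have := r0; lra. Qed.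
Let u01 t : 0 <= u t <= 2 * (1 - delta).
Proof.
rewrite /u /delta opprB addrC subrK mulrC mulr_ge0 ?(ltW r0)//=.
by rewrite ler_wpM2r// ltW.
Qed.

Let sqnorm_cderiv_smoothed_le l t :
  sqnorm (fourier (cderiv (l.+1%:R * N%:R) (smoothed_poly l)) t) <=
  2 * r * sigma2 * (u t * (`|1 - u t| ^+ l + l%:R * u t * `|1 - u t| ^+ l.-1) ^+ 2).
Proof.
rewrite sqnorm_cderiv_smoothed.
rewrite [leRHS](_ : _ = (r ^+ 2 * (sigma2 * (2 * phi t))) *
   (`|1 - u t| ^+ l + l%:R * u t * `|1 - u t| ^+ l.-1) ^+ 2); last by rewrite /u; ring.
apply: ler_pM; rewrite ?sqr_ge0//.
  by rewrite exprMn ler_wpM2l ?sqr_ge0 ?psi_le.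
have : 0 <= u t by case/andP: (u01 t).
move: (u t) => v v0.
have c0 : 0 <= `|1 - v| ^+ l + l%:R * v * `|1 - v| ^+ l.-1.
  by rewrite addr_ge0 ?exprn_ge0// mulr_ge0 ?exprn_ge0// mulr_ge0.
rewrite -[leLHS]real_normK ?num_real// lerXn2r ?nnegrE//.
rewrite (le_trans (ler_normB _ _))// normrX lerD// !normrM normrX.
by rewrite (ger0_norm v0) ger0_norm.
Qed.

(* The tangent line of 1 / x at y lies below its graph. *)
Let jensen (tau t : R) : 0 < tau -> (1 + tau * u t)^-1 <=
  \sum_(k < N) 2 * f k * (1 + tau * r * (1 - cos (k.+1%:R * t)))^-1.
Proof.
move=> tau0; pose x k := 1 + tau * r * (1 - cos (k.+1%:R * t)).
set y := 1 + tau * u t.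
have x0 k : 0 < x k.
  have : 0 <= tau * r * (1 - cos (k.+1%:R * t)).
    by rewrite !mulr_ge0// ?(ltW tau0) ?(ltW r0)// subr_ge0 cos_le1.
  rewrite /x; lra.
have y0 : 0 < y.
  have : 0 <= tau * u t by rewrite mulr_ge0 ?(ltW tau0)//; case/andP: (u01 t).
  rewrite /y; lra.
have yE : y = \sum_(k < N) 2 * f k * x k.
  rewrite /y /u /phi -[X in X + _]f_sum !mulr_sumr -big_split/=.
  by apply: eq_bigr => k _; rewrite /x; ring.
have -> : y^-1 = \sum_(k < N) 2 * f k * (2 / y - x k / y ^+ 2).
  transitivity (\sum_(k < N) (2 * f k * (2 / y) - 2 * f k * x k / y ^+ 2)).
    rewrite sumrB -!mulr_suml f_sum -yE; field; exact: lt0r_neq0.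
  by apply: eq_bigr => k _; ring.
apply: ler_sum => k _; rewrite ler_wpM2l ?mulr_ge0// -/(x k).
have := x0 k; move: (x k) => z z0.
rewrite -subr_ge0 (_ : _ - _ = (z - y) ^+ 2 / (z * y ^+ 2)).
  by rewrite divr_ge0 ?sqr_ge0// mulr_ge0 ?sqr_ge0// ltW.
by field; rewrite !gt_eqF.
Qed.

Let avg Q (tau : R) := Q%:R^-1 * \sum_(j < Q) (1 + tau * u (j%:R * root_angle R Q))^-1.

Let avg_le1 Q (tau : R) : (0 < Q)%N -> 0 < tau -> avg Q tau <= 1.
Proof.
move=> Q0 tau0; rewrite /avg ler_pdivrMl ?ltr0n// mulr1.
rewrite -[leRHS](_ : \sum_(j < Q) 1 = _); last by rewrite sumr_const card_ord.
apply: ler_sum => j _; rewrite invf_le1.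
  by rewrite lerDl mulr_ge0 ?(ltW tau0)//; case/andP: (u01 (j%:R * root_angle R Q)).
by rewrite ltr_wpDr// mulr_ge0 ?(ltW tau0)//; case/andP: (u01 (j%:R * root_angle R Q)).
Qed.

(** [jensen] reduces the average to single frequencies k + 1, which lie strictly between 0 and Q;
    for each of them the bound over a prime is the same. *)
Let avg_le Q (tau : R) : prime Q -> (N < Q)%N -> 0 < tau ->
  avg Q tau <= 2 / Q%:R + 4 / Num.sqrt (2 * (tau * r)).
Proof.
move=> pQ NQ tau0; have Q0 := prime_gt0 pQ.
have Q0' : 0 < Q%:R :> R by rewrite ltr0n.
have l0 : 0 < tau * r by rewrite mulr_gt0.
have s0 : 0 < Num.sqrt (2 * (tau * r)) by rewrite sqrtr_gt0 mulr_gt0.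
rewrite /avg ler_pdivrMl//.
apply: (@le_trans _ _ (\sum_(j < Q) \sum_(k < N) 2 * f k *
    (1 + tau * r * (1 - cos (k.+1%:R * (j%:R * root_angle R Q))))^-1)).
  by apply: ler_sum => j _; exact: jensen.
rewrite exchange_big/=.
apply: (@le_trans _ _ (\sum_(k < N) 2 * f k * (2 * (1 + 2 * (Q%:R / Num.sqrt (2 * (tau * r))))))).
  apply: ler_sum => k _; rewrite -mulr_sumr ler_wpM2l ?mulr_ge0//.
  by apply: sum_inv_1Dcos_mul_le => //=; rewrite (leq_ltn_trans (ltn_ord k)).
rewrite -mulr_suml f_sum mul1r le_eqVlt; apply/orP; left; apply/eqP.
by field; rewrite !gt_eqF.
Qed.

Let size_walk : (size walk_poly <= (2 * N).+1)%N.
Proof.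
apply: (leq_trans (size_sum _ _ _)); apply/bigmax_leqP => k _.
rewrite (leq_trans (size_scale_leq _ _))// (leq_trans (size_polyD _ _))//.
rewrite !size_polyXn geq_max mul2n -addnn !ltnS leq_add2l ltn_ord/=.
by rewrite (leq_trans (leq_subr _ _)) ?leq_addr.
Qed.

Let size_XN : (size ('X^N : {poly R}) <= (2 * N).+1)%N.
Proof. by rewrite size_polyXn ltnS leq_pmull. Qed.

Let size_smoothed l : (size (smoothed_poly l) <= (2 * N * l.+1).+1)%N.
Proof.
have sl : (size (lazy_poly r) <= (2 * N).+1)%N.
  rewrite (leq_trans (size_polyD _ _))// geq_max.
  by rewrite !(leq_trans (size_scale_leq _ _)).
have sX n : (size (lazy_poly r ^+ n) <= (2 * N * n).+1)%N.
  rewrite (leq_trans (size_poly_exp_leq _ _))// ltnS leq_mul2r -ltnS.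
  by rewrite orbC ltnS -subn1 leq_subLR add1n sl.
rewrite /smoothed_poly (leq_trans (size_polyMleq _ _))//.
have sw : (size (r *: (walk_poly - 'X^N)) <= (2 * N).+1)%N.
  rewrite (leq_trans (size_scale_leq _ _))// (leq_trans (size_polyD _ _))//.
  by rewrite geq_max size_polyN size_walk size_XN.
rewrite -subn1 leq_subLR add1n (leq_trans (leq_add sw (sX l)))//.
by rewrite mulnS addSn addnS.
Qed.

Let sigma2_ge1 : 1 <= sigma2.
Proof.
rewrite /sigma2 -[leLHS]f_sum mulr_sumr; apply: ler_sum => k _.
by rewrite ler_wpM2l// ler_peMl// -natrX ler1n expn_gt0.
Qed.

(* Cauchy-Schwarz with the weights 1 + ((i - c) / b)^2, where c = (l + 1) N is the
   centre of the polynomial and b, of order sqrt (l + 1) sigma for fixed r, its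
   width. The numerals 81 and 2025 are replaced by variables because they are
   unary. *)
Theorem smoothed_l1_le l :
  (\sum_(i < size (smoothed_poly l)) `|(smoothed_poly l)`_i|) ^+ 2 <=
  26 * (81 + 4050) * (1 + Num.sqrt sigma2) / ((1 - r) ^+ 3 * l.+1%:R ^+ 2).
Proof.
have [c1 [c2 [c12 c2E c0]]] : exists c1 c2 : R,
    [/\ 81 + 4050 = c1 + 2 * c2, (c1, c2) = (81, 2025) & 0 <= c1 + 2 * c2].
  exists 81, 2025; split; [by rewrite -natrM|reflexivity|].
  by apply: addr_ge0; last apply: mulr_ge0; exact: ler0n.
rewrite c12.
set P := smoothed_poly l.
pose tau := l.+1%:R * delta; have tau0 : 0 < tau by rewrite mulr_gt0.
pose s := Num.sqrt sigma2.
have s2 : s ^+ 2 = sigma2 by rewrite sqr_sqrtr// (le_trans ler01 sigma2_ge1).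
have s0 : 0 < s by rewrite sqrtr_gt0 (lt_le_trans ltr01 sigma2_ge1).
pose g := Num.sqrt (tau * r).
have g2 : g ^+ 2 = tau * r by rewrite sqr_sqrtr// ltW// mulr_gt0.
have g0 : 0 < g by rewrite sqrtr_gt0 mulr_gt0.
(* With this width, b^-2 times the bound on the centred moment is 2 c2 / tau^2 * kappa, the same
   order as the bound on the plain sum of squares. *)
pose b := g * s / delta; have b0 : 0 < b by rewrite divr_gt0// mulr_gt0.
(* Q exceeds the degree of P, for Parseval; N, so that all frequencies are non-zero modulo Q; and b,
   so that the error 2 / Q in [avg_le] stays bounded after multiplication by b. *)
have [Q Qbig pQ] := prime_above (2 * N * l.+1 + N + Num.bound b).
have Q0 := prime_gt0 pQ.
have Q0' : 0 < Q%:R :> R by rewrite ltr0n.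
have NQ : (N < Q)%N.
  by rewrite (leq_ltn_trans _ Qbig)// addnAC leq_addl.
have bQ : b <= Q%:R.
  rewrite (le_trans (ltW (archi_boundP (ltW b0))))// ler_nat ltnW//.
  by rewrite (leq_ltn_trans _ Qbig)// leq_addl.
have cQ : (l.+1 * N <= Q)%N.
  rewrite ltnW// (leq_ltn_trans _ Qbig)// -addnA (leq_trans _ (leq_addr _ _))//.
  by rewrite mulnC leq_mul2r leq_pmull// orbT.
have sQ : (size P <= Q)%N.
  rewrite (leq_trans (size_smoothed l))// (leq_ltn_trans _ Qbig)//.
  by rewrite -addnA leq_addr.
have sP : \sum_(i < size P) `|P`_i| = \sum_(i < Q) `|P`_i|.
  rewrite (big_ord_widen _ (fun i => `|P`_i|) sQ) big_mkcond/=.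
  apply: eq_bigr => i _; case: ltnP => // h.
  by rewrite nth_default// normr0.
pose kappa := avg Q tau.
have S0 : \sum_(i < Q) P`_i ^+ 2 <= c1 / tau ^+ 2 * kappa.
  rewrite -(ler_pM2l Q0') -parseval// /kappa /avg mulrCA mulVKf ?gt_eqF// mulr_sumr.
  by case: c2E => -> _; apply: ler_sum => j _; rewrite sqnorm_smoothed smooth_bound0.
have S1 : \sum_(i < Q) (i%:R - l.+1%:R * N%:R) ^+ 2 * P`_i ^+ 2 <=
    2 * r * sigma2 * (c2 / (delta ^+ 2 * tau)) * kappa.
  have -> : \sum_(i < Q) (i%:R - l.+1%:R * N%:R) ^+ 2 * P`_i ^+ 2 =
     \sum_(i < Q) (cderiv (l.+1%:R * N%:R) P)`_i ^+ 2.
    by apply: eq_bigr => i _; rewrite coef_cderiv exprMn.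
  have sQ' : (size (cderiv (l.+1%:R * N%:R) P) <= Q)%N.
    apply/leq_sizeP => i Qi; rewrite coef_cderiv nth_default ?mulr0//.
    exact: leq_trans Qi.
  rewrite -(ler_pM2l Q0') -parseval// /kappa /avg mulrCA mulVKf ?gt_eqF// mulr_sumr.
  apply: ler_sum => j _; rewrite (le_trans (sqnorm_cderiv_smoothed_le _ _))//.
  rewrite -[leRHS]mulrA ler_wpM2l//; last by case: c2E => _ ->; exact: smooth_bound1.
  apply: mulr_ge0; last exact: le_trans ler01 sigma2_ge1.
  by rewrite mulr_ge0// ltW.
rewrite sP.
pose a (i : 'I_Q) := 1 + ((i%:R - (l.+1 * N)%:R) / b) ^+ 2.
have a0 i : 0 < a i by rewrite ltr_wpDr// sqr_ge0.
have kappa0 : 0 <= kappa.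
  rewrite mulr_ge0 ?invr_ge0// sumr_ge0// => j _.
  by rewrite invr_ge0 addr_ge0// mulr_ge0 ?(ltW tau0)//; case/andP: (u01 (j%:R * root_angle R Q)).
have SA : \sum_i a i * P`_i ^+ 2 <= (c1 + 2 * c2) / tau ^+ 2 * kappa.
  have -> : \sum_i a i * P`_i ^+ 2 = \sum_(i < Q) P`_i ^+ 2 +
     b ^- 2 * \sum_(i < Q) (i%:R - l.+1%:R * N%:R) ^+ 2 * P`_i ^+ 2.
    rewrite mulr_sumr -big_split/=; apply: eq_bigr => i _.
    have E (x y z : R) : (1 + (x / y) ^+ 2) * z = z + y ^- 2 * (x ^+ 2 * z).
      by rewrite expr_div_n mulrDl mul1r mulrA [y ^- 2 * _]mulrC.
    by rewrite -natrM E.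
  rewrite [X in X / _ * _]addrC 2!mulrDl addrC; apply: lerD => //.
  rewrite ler_pdivrMl ?exprn_gt0// (le_trans S1)// [leRHS]mulrA ler_wpM2r//.
  rewrite le_eqVlt; apply/orP; left; apply/eqP.
  rewrite /b expr_div_n exprMn g2 s2.
  by field; rewrite !gt_eqF.
have CS : (\sum_(i < Q) `|P`_i|) ^+ 2 <= 2 * (1 + 2 * b) * ((c1 + 2 * c2) / tau ^+ 2 * kappa).
  have -> : \sum_(i < Q) `|P`_i| = \sum_(i < Q) (Num.sqrt (a i))^-1 * (Num.sqrt (a i) * `|P`_i|).
    by apply: eq_bigr => i _; rewrite mulKf// gt_eqF// sqrtr_gt0.
  rewrite (le_trans (cauchy_schwarz_sum _ _))//.
  apply: ler_pM.
  - by apply: sumr_ge0 => *; exact: sqr_ge0.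
  - by apply: sumr_ge0 => *; exact: sqr_ge0.
  - rewrite (le_trans _ (sum_inv_1Dsqr_center_le b0 cQ))//.
    by apply: ler_sum => i _; rewrite exprVn sqr_sqrtr// ltW.
  - rewrite (le_trans _ SA)//; apply: ler_sum => i _.
    by rewrite exprMn sqr_sqrtr ?(ltW (a0 i))// real_normK ?num_real.
(* The summand 1 is paired with kappa <= 1, the summand 2 b with the decay of kappa: b / g = s /
   delta does not depend on l. *)
have K : (1 + 2 * b) * kappa <= 13 * (1 + s) / delta.
  have k1 : kappa <= 1 by exact: avg_le1.
  have k2 : kappa <= 2 / Q%:R + 4 / g.
    rewrite (le_trans (avg_le pQ NQ tau0))// lerD2l ler_wpM2l// lef_pV2 ?posrE//.
      by apply: ler_wsqrtr; have := mulr_gt0 tau0 r0; lra.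
    by rewrite sqrtr_gt0 mulr_gt0// mulr_gt0.
  have b2 : b * (2 / Q%:R) <= 2.
    by rewrite mulrCA ler_piMr// ler_pdivrMr// mul1r.
  have b3 : b * (4 / g) = 4 * (s / delta) by rewrite /b; field; rewrite !gt_eqF.
  have : b * kappa <= b * (2 / Q%:R + 4 / g) by rewrite ler_pM2l.
  rewrite mulrDr b3 => b4.
  rewrite -mulrA mulrDl mul1r.
  have : 1 <= delta^-1 by rewrite invf_ge1//; case/andP: d01.
  have : 0 <= s / delta by rewrite divr_ge0// ltW.
  lra.
rewrite (le_trans CS)//.
have -> : 2 * (1 + 2 * b) * ((c1 + 2 * c2) / tau ^+ 2 * kappa) =
  2 * (c1 + 2 * c2) / tau ^+ 2 * ((1 + 2 * b) * kappa) by ring.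
have c0' : 0 <= 2 * (c1 + 2 * c2) / tau ^+ 2.
  by apply: divr_ge0; [rewrite mulr_ge0|rewrite sqr_ge0].
apply: (le_trans (ler_wpM2l c0' K)).
rewrite -/delta -/s /tau.
move: (c1 + 2 * c2) => c.
rewrite le_eqVlt; apply/orP; left; apply/eqP.
have -> : (26 : R) = 2 * 13 by rewrite -natrM.
by field; rewrite !gt_eqF.
Qed.

End lattice_walk.

(** Packages the smoothing estimate with an abstract constant, so that the later sections need no
    numerals from it. *)
Definition smoothing_constant (R : realType) (C : R) :=
  forall (N : nat) (f : nat -> R), (forall k, 0 <= f k) ->
  \sum_(k < N) 2 * f k = 1 -> forall r, 0 < r < 1 -> forall l,
  (\sum_(i < size (smoothed_poly N f r l)) `|(smoothed_poly N f r l)`_i|) ^+ 2 <=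
  C * (1 + Num.sqrt (2 * \sum_(k < N) k.+1%:R ^+ 2 * f k)) /
  ((1 - r) ^+ 3 * l.+1%:R ^+ 2).

Lemma smoothing_constant_exists (R : realType) :
  exists2 C : R, 0 < C & smoothing_constant C.
Proof.
exists (26 * (81 + 4050)); last exact: smoothed_l1_le.
by apply: mulr_gt0; last apply: addr_gt0; rewrite ltr0n.
Qed.

(** * Convolution operators and finite walks *)

Section translation_operators.
Variables (R : realType) (V : zmodType).
Implicit Types (h g : V -> R) (v : V) (c : R).

Definition shift v h : V -> R := fun x => h (x + v).

Definition linear_op (B : (V -> R) -> V -> R) :=
  forall c h g, B (fun x => c * h x + g x) = (fun x => c * B h x + B g x).

Definition shift_invariant (B : (V -> R) -> V -> R) :=
  forall v h, B (shift v h) = shift v (B h).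

(* The linear bicommutant of the translations. It is a commutative ring that
   contains all finitely supported convolution operators. *)
Record convop := Convop {
  op_fun :> (V -> R) -> V -> R ;
  _ : linear_op op_fun ;
  _ : forall B, linear_op B -> shift_invariant B ->
        forall h, op_fun (B h) = B (op_fun h) }.

HB.instance Definition _ := gen_eqMixin convop.
HB.instance Definition _ := gen_choiceMixin convop.

Implicit Types A B : convop.

Lemma convop_linear A : linear_op A. Proof. by case: A. Qed.

Lemma convop_comm A (B : (V -> R) -> V -> R) : linear_op B ->
  shift_invariant B -> forall h, A (B h) = B (A h).
Proof. by case: A => a la ca lB sB h; exact: ca. Qed.

Lemma shift_linear v : linear_op (shift v). Proof. by []. Qed.

Lemma shift_shift_invariant v : shift_invariant (shift v).
Proof. by move=> w h; apply/funext => x; rewrite /shift addrAC. Qed.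

Lemma convop_shift A : shift_invariant A.
Proof.
by move=> v h; apply: convop_comm => //; exact: shift_shift_invariant.
Qed.

Lemma convopP A B : (forall h x, A h x = B h x) -> A = B.
Proof.
case: A B => [a la ca] [b lb cb]/= ab.
have {}ab : a = b by apply/funext => h; apply/funext => x; exact: ab.
by move: la ca lb cb; rewrite ab => *; congr Convop; exact: Prop_irrelevance.
Qed.

Lemma linear_op0 (B : (V -> R) -> V -> R) : linear_op B ->
  B (fun=> 0) = (fun=> 0).
Proof.
move=> lB; have := lB (-1) (fun=> 0) (fun=> 0).
have -> : (fun x : V => -1 * 0 + 0 : R) = (fun=> 0) by apply/funext => x; rewrite mulr0 addr0.
by move=> E; rewrite [LHS]E; apply/funext => x; rewrite mulN1r addNr.
Qed.

Lemma linear_opZ (B : (V -> R) -> V -> R) c h : linear_op B ->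
  B (fun x => c * h x) = (fun x => c * B h x).
Proof.
move=> lB; have := lB c h (fun=> 0); rewrite linear_op0//.
have -> : (fun x => c * h x + 0) = (fun x => c * h x) by apply/funext => x; rewrite addr0.
by move=> ->; apply/funext => x; rewrite addr0.
Qed.

Lemma linear_opD (B : (V -> R) -> V -> R) h g : linear_op B ->
  B (fun x => h x + g x) = (fun x => B h x + B g x).
Proof.
move=> lB; have := lB 1 h g.
have -> : (fun x => 1 * h x + g x) = (fun x => h x + g x) by apply/funext => x; rewrite mul1r.
by move=> ->; apply/funext => x; rewrite mul1r.
Qed.

Definition convop_add A B : convop.
Proof.
refine (@Convop (fun h x => A h x + B h x) _ _).
- by move=> c h g; apply/funext => x; rewrite !convop_linear mulrDr addrACA.
- by move=> D lD sD h; rewrite (convop_comm A lD sD) (convop_comm B lD sD) linear_opD.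
Defined.

Definition convop_scalar c : convop.
Proof.
refine (@Convop (fun h x => c * h x) _ _).
- by move=> d h g; apply/funext => x; rewrite mulrDr mulrCA.
- by move=> D lD sD h; rewrite linear_opZ.
Defined.

Definition convop_mul A B : convop.
Proof.
refine (@Convop (fun h => A (B h)) _ _).
- by move=> c h g; rewrite (convop_linear B) (convop_linear A).
- by move=> D lD sD h; rewrite (convop_comm B lD sD) (convop_comm A lD sD).
Defined.

Definition convop_opp A := convop_mul (convop_scalar (-1)) A.

Definition convop_shift_by v : convop.
Proof.
refine (@Convop (shift v) (@shift_linear v) _).
by move=> D lD sD h; rewrite sD.
Defined.

Fact convop_addA : associative convop_add.
Proof. by move=> A B D; apply: convopP => h x /=; rewrite addrA. Qed.
Fact convop_addC : commutative convop_add.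
Proof. by move=> A B; apply: convopP => h x /=; rewrite addrC. Qed.
Fact convop_add0 : left_id (convop_scalar 0) convop_add.
Proof. by move=> A; apply: convopP => h x /=; rewrite mul0r add0r. Qed.
Fact convop_addN : left_inverse (convop_scalar 0) convop_opp convop_add.
Proof. by move=> A; apply: convopP => h x /=; rewrite mulN1r addNr mul0r. Qed.

HB.instance Definition _ := GRing.isZmodule.Build convop
  convop_addA convop_addC convop_add0 convop_addN.

Fact convop_mulA : associative convop_mul.
Proof. by move=> A B D; exact: convopP. Qed.
(** Each element is itself linear and shift invariant, so the commutation clause of the other one
    applies to it. *)
Fact convop_mulC : commutative convop_mul.
Proof.
move=> A B; apply: convopP => h x /=; rewrite convop_comm//.
- exact: convop_linear.
- exact: convop_shift.
Qed.
Fact convop_mul1 : left_id (convop_scalar 1) convop_mul.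
Proof. by move=> A; apply: convopP => h x /=; rewrite mul1r. Qed.
Fact convop_mulDl : left_distributive convop_mul convop_add.
Proof. by move=> A B D; exact: convopP. Qed.
Fact convop_1neq0 : convop_scalar 1 != 0.
Proof.
apply/eqP => /(congr1 (fun A : convop => A (fun=> 1) 0))/=.
by rewrite mul1r mul0r => /eqP; rewrite oner_eq0.
Qed.

HB.instance Definition _ := GRing.Zmodule_isComNzRing.Build convop
  convop_mulA convop_mulC convop_mul1 convop_mulDl convop_1neq0.

Lemma convop_addE A B h x : (A + B) h x = A h x + B h x. Proof. by []. Qed.
Lemma convop_mulE A B h x : (A * B) h x = A (B h) x. Proof. by []. Qed.
Lemma convop_scalarE c h x : convop_scalar c h x = c * h x. Proof. by []. Qed.
Lemma convop_oppE A h x : (- A) h x = - A h x.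
Proof. by rewrite [LHS]mulN1r. Qed.

Fact convop_scalar_is_additive : zmod_morphism convop_scalar.
Proof.
move=> c d; apply: convopP => h x.
by rewrite convop_addE convop_oppE !convop_scalarE mulrBl.
Qed.

Fact convop_scalar_is_multiplicative : monoid_morphism convop_scalar.
Proof.
split => // c d; apply: convopP => h x.
by rewrite convop_mulE !convop_scalarE mulrA.
Qed.

HB.instance Definition _ := GRing.isZmodMorphism.Build R convop convop_scalar
  convop_scalar_is_additive.
HB.instance Definition _ := GRing.isMonoidMorphism.Build R convop convop_scalar
  convop_scalar_is_multiplicative.

Local Notation sc := convop_scalar.
Local Notation tau := convop_shift_by.

Lemma convop_shift0 : tau 0 = 1.
Proof. by apply: convopP => h x; rewrite /= /shift addr0 mul1r. Qed.

Lemma convop_shiftD v w : tau (v + w) = tau v * tau w.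
Proof. by apply: convopP => h x; rewrite convop_mulE/= /shift addrA addrAC. Qed.

Lemma convop_shiftMn v n : tau (v *+ n) = tau v ^+ n.
Proof.
elim: n => [|n IH]; first by rewrite mulr0n convop_shift0.
by rewrite mulrS convop_shiftD IH exprS.
Qed.

(** Operator norm at most [c] for the supremum norm. For convolution with a finitely supported
    signed measure this norm is the total variation. *)
Definition op_bound A c :=
  forall h C, (forall x, `|h x| <= C) -> forall x, `|A h x| <= c * C.

Lemma op_bound_le A a b : a <= b -> op_bound A a -> op_bound A b.
Proof.
move=> ab HA h C hC x; rewrite (le_trans (HA _ _ hC x))// ler_wpM2r//.
exact: le_trans (hC 0).
Qed.

Lemma op_boundD A B a b : op_bound A a -> op_bound B b -> op_bound (A + B) (a + b).
Proof.
move=> HA HB h C hC x; rewrite convop_addE mulrDl (le_trans (ler_normD _ _))//.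
by rewrite lerD ?HA ?HB.
Qed.

Lemma op_boundN A a : op_bound A a -> op_bound (- A) a.
Proof. by move=> HA h C hC x; rewrite convop_oppE normrN HA. Qed.

Lemma op_boundM A B a b : op_bound A a -> op_bound B b -> op_bound (A * B) (a * b).
Proof. by move=> HA HB h C hC x; rewrite -mulrA; apply: HA => y; exact: HB. Qed.

Lemma op_bound_scalar c : op_bound (sc c) `|c|.
Proof. by move=> h C hC x; rewrite /= normrM ler_wpM2l. Qed.

Lemma op_bound_pscalar c : 0 <= c -> op_bound (sc c) c.
Proof. by move=> c0; have := op_bound_scalar c; rewrite ger0_norm. Qed.

Lemma op_bound0 : op_bound 0 0.
Proof. exact: (op_bound_pscalar (lexx 0)). Qed.

Lemma op_bound1 : op_bound 1 1.
Proof. exact: (op_bound_pscalar ler01). Qed.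

Lemma op_bound_shift v : op_bound (tau v) 1.
Proof. by move=> h C hC x; rewrite mul1r; exact: hC. Qed.

Lemma op_boundX A a n : op_bound A a -> op_bound (A ^+ n) (a ^+ n).
Proof.
move=> HA; elim: n => [|n IH]; first by rewrite !expr0; exact: op_bound1.
by rewrite !exprS; exact: op_boundM.
Qed.

Lemma op_bound_sum I (r : seq I) (F : I -> convop) (b : I -> R) :
  (forall i, op_bound (F i) (b i)) -> op_bound (\sum_(i <- r) F i) (\sum_(i <- r) b i).
Proof.
move=> HF; elim/big_ind2: _ => [|x y z w|i _]; [exact: op_bound0|exact: op_boundD|exact: HF].
Qed.

Lemma op_boundMn A a n : op_bound A a -> op_bound (A *+ n) (a *+ n).
Proof.
move=> HA; elim: n => [|n IH]; first by rewrite !mulr0n; exact: op_bound0.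
by rewrite !mulrS; exact: op_boundD.
Qed.

(** Powers of a translation have norm at most 1, so the l1 norm of the coefficients dominates. *)
Lemma op_bound_poly (P : {poly R}) v :
  op_bound (map_poly sc P).[tau v] (\sum_(i < size P) `|P`_i|).
Proof.
have sP : (size (map_poly sc P) <= size P)%N by exact: size_poly.
rewrite (horner_coef_wide _ sP); apply: op_bound_sum => i.
rewrite -[`|_|]mulr1 coef_map; apply: op_boundM; first exact: op_bound_scalar.
by rewrite -convop_shiftMn; exact: op_bound_shift.
Qed.

End translation_operators.

(** * From generating polynomials to walk operators *)

Section walk_operator.
Variables (R : realType) (V : zmodType).
Local Notation sc := (@convop_scalar R V).
Local Notation tau := (@convop_shift_by R V).

Definition symm_step N (f : nat -> R) (y : V) : convop R V :=
  \sum_(k < N) sc (f k) * (tau (y *+ k.+1) + tau (- (y *+ k.+1))).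

Lemma op_bound_symm_step N (f : nat -> R) y : (forall k, 0 <= f k) ->
  \sum_(k < N) 2 * f k = 1 -> op_bound (symm_step N f y) 1.
Proof.
move=> f0 <-; apply: op_bound_sum => k; rewrite [2 * _]mulrC.
apply: op_boundM; first exact: op_bound_pscalar.
have -> : (2 : R) = 1 + 1 by [].
by apply: op_boundD; exact: op_bound_shift.
Qed.

(** The leading power of the translation collects the factors X^N that cleared the negative
    exponents in the l + 1 polynomial factors. *)
Lemma horner_smoothed_poly N f y r l :
  (map_poly sc (smoothed_poly N f r l)).[tau y] =
  tau y ^+ (N * l.+1) *
  (sc r * (symm_step N f y - 1) * (sc (1 - r) + sc r * symm_step N f y) ^+ l).
Proof.
have tK k : tau y ^+ k * tau (- (y *+ k)) = 1.
  by rewrite -convop_shiftMn -convop_shiftD subrr convop_shift0.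
pose ev P := (map_poly sc P).[tau y].
have evD P Q : ev (P + Q) = ev P + ev Q by rewrite /ev rmorphD hornerD.
have evM P Q : ev (P * Q) = ev P * ev Q by rewrite /ev rmorphM hornerM.
have evZ c P : ev (c *: P) = sc c * ev P by rewrite /ev map_polyZ hornerZ.
have evXn n : ev 'X^n = tau y ^+ n by rewrite /ev map_polyXn hornerXn.
have evX P n : ev (P ^+ n) = ev P ^+ n.
  elim: n => [|n IH]; first by rewrite expr0 -(expr0 'X) (evXn 0) !expr0.
  by rewrite !exprS evM IH.
have ev0 : ev 0 = 0 by rewrite /ev rmorph0 horner0.
have ev_walk : ev (walk_poly N f) = tau y ^+ N * symm_step N f y.
  rewrite /walk_poly (big_morph ev evD ev0) /symm_step mulr_sumr.
  apply: eq_bigr => k _; rewrite evZ evD !evXn mulrCA.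
  congr (_ * _); rewrite mulrDr exprD convop_shiftMn; congr (_ + _).
  by rewrite -[in tau y ^+ N](subnK (ltn_ord k)) exprD -mulrA tK mulr1.
have ev_lazy : ev (lazy_poly N f r) =
    tau y ^+ N * (sc (1 - r) + sc r * symm_step N f y).
  by rewrite /lazy_poly evD !evZ evXn ev_walk; ring.
have evN P : ev (- P) = - ev P by rewrite /ev rmorphN hornerN.
rewrite -/(ev _) /smoothed_poly evM evX ev_lazy evZ evD evN ev_walk evXn.
by rewrite exprMn mulnS exprD exprM; ring.
Qed.

Variable C : R.
Hypothesis smoothingC : smoothing_constant C.

Lemma op_bound_smoothed N (f : nat -> R) y r l w : (forall k, 0 <= f k) ->
  \sum_(k < N) 2 * f k = 1 -> 0 < r < 1 -> 0 <= w ->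
  C * (1 + Num.sqrt (2 * \sum_(k < N) k.+1%:R ^+ 2 * f k)) / (1 - r) ^+ 3 <= w ^+ 2 ->
  op_bound (sc r * (symm_step N f y - 1) * (sc (1 - r) + sc r * symm_step N f y) ^+ l)
    (w / l.+1%:R).
Proof.
move=> f0 f1 r01 w0 Cw.
set A := (X in op_bound X _).
(* The clearing factor is undone by the inverse translation, again of norm at most 1. *)
have -> : A = tau (- (y *+ (N * l.+1))) * (map_poly sc (smoothed_poly N f r l)).[tau y].
  rewrite horner_smoothed_poly -/A mulrA -convop_shiftMn -convop_shiftD.
  by rewrite addNr convop_shift0 mul1r.
rewrite -[w / _]mul1r; apply: op_boundM; first exact: op_bound_shift.
apply: op_bound_le (op_bound_poly _ _).
have S0 : 0 <= \sum_(i < size (smoothed_poly N f r l)) `|(smoothed_poly N f r l)`_i|.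
  by rewrite sumr_ge0.
have w1 : 0 <= w / l.+1%:R by rewrite divr_ge0.
rewrite -(@ler_pXn2r _ 2) ?nnegrE// (le_trans (smoothingC f0 f1 r01 l))//.
by rewrite invfM mulrA expr_div_n ler_wpM2r// invr_ge0 exprn_ge0.
Qed.

End walk_operator.

(** * Smoothing bounds under binomial expansion *)

Section binomial_bounds.
Variables (R : realType) (V : zmodType).
Implicit Types (A B H S X Y : convop R V) (x y alpha beta eta s : R).

(** The identity C(m, i) / (i + 1) = C(m + 1, i + 1) / (m + 1) turns the expansion into part of that
    of (beta + eta)^(m + 1). The bound keeps its form when H is added to B. *)
Lemma op_bound_binomial Y B H y beta eta m : 0 <= y -> 0 <= beta -> 0 <= eta ->
  (forall b, op_bound (Y * B ^+ b) (y * beta ^+ b.+1 / b.+1%:R)) ->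
  op_bound H eta ->
  op_bound (Y * (B + H) ^+ m) (y * (beta + eta) ^+ m.+1 / m.+1%:R).
Proof.
move=> y0 b0 e0 hB hH; rewrite addrC exprDn mulr_sumr.
apply: (@op_bound_le _ _ _ (\sum_(i < m.+1)
    (eta ^+ (m - i) * (y * beta ^+ i.+1 / i.+1%:R)) *+ 'C(m, i))); last first.
  apply: op_bound_sum => i; rewrite mulrnAr mulrCA; apply: op_boundMn.
  by apply: op_boundM; first exact: op_boundX.
pose t j := eta ^+ (m.+1 - j) * beta ^+ j *+ 'C(m.+1, j).
have t0 j : 0 <= t j by rewrite mulrn_wge0// mulr_ge0// exprn_ge0.
have tS : \sum_(i < m.+1) t i.+1 <= (beta + eta) ^+ m.+1.
  have -> : (beta + eta) ^+ m.+1 = \sum_(j < m.+2) t j by rewrite addrC exprDn.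
  by rewrite [leRHS]big_ord_recl lerDr.
have ym0 : 0 <= y / m.+1%:R by rewrite divr_ge0.
rewrite [leRHS]mulrAC (le_trans _ (ler_wpM2l ym0 tS))// mulr_sumr.
apply: ler_sum => i _; rewrite /t subSS le_eqVlt; apply/orP; left; apply/eqP.
rewrite -[in LHS]mulr_natr -[in RHS](mulr_natr (_ * _)).
have /(congr1 (fun k => k%:R : R)) := mul_bin_diag m.+1 i; rewrite /= !natrM => E.
have -> : ('C(m.+1, i.+1)%:R : R) = m.+1%:R * 'C(m, i)%:R / i.+1%:R.
  by rewrite E mulrAC mulfV ?mul1r// pnatr_eq0.
by field; rewrite ?(nat1r, =^~ natrD) !pnatr_eq0.
Qed.

(** Here C(k, i) / ((i + 1)(k - i + 1)) = C(k + 2, i + 1) / ((k + 1)(k + 2)), so the sum is the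
    expansion of (alpha + s)^(k + 2) without its first and last terms. *)
Lemma op_bound_binomial2 X Y A S x y alpha s k :
  0 <= x -> 0 <= y -> 0 <= alpha -> 0 <= s ->
  (forall b, op_bound (X * A ^+ b) (x * alpha ^+ b.+1 / b.+1%:R)) ->
  (forall b, op_bound (Y * S ^+ b) (y * s ^+ b.+1 / b.+1%:R)) ->
  op_bound (X * Y * (A + S) ^+ k)
    (x * y * (alpha + s) ^+ k.+2 / (k.+1%:R * k.+2%:R)).
Proof.
move=> x0 y0 a0 s0 hA hS; rewrite exprDn mulr_sumr.
apply: (@op_bound_le _ _ _ (\sum_(i < k.+1)
    ((x * alpha ^+ (k - i).+1 / (k - i).+1%:R) * (y * s ^+ i.+1 / i.+1%:R)) *+ 'C(k, i))); last first.
  apply: op_bound_sum => i; rewrite mulrnAr mulrACA; apply: op_boundMn.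
  exact: op_boundM.
pose t j := alpha ^+ (k.+2 - j) * s ^+ j *+ 'C(k.+2, j).
have t0 j : 0 <= t j by rewrite mulrn_wge0// mulr_ge0// exprn_ge0.
have tS : \sum_(i < k.+1) t i.+1 <= (alpha + s) ^+ k.+2.
  have -> : (alpha + s) ^+ k.+2 = \sum_(j < k.+3) t j by rewrite exprDn.
  rewrite [leRHS]big_ord_recl [X in _ <= _ + X]big_ord_recr/=.
  by rewrite addrCA lerDl addr_ge0.
have xy0 : 0 <= x * y / (k.+1%:R * k.+2%:R) by rewrite divr_ge0 ?mulr_ge0.
rewrite [leRHS]mulrAC (le_trans _ (ler_wpM2l xy0 tS))// mulr_sumr.
apply: ler_sum => i _; rewrite /t subSS le_eqVlt; apply/orP; left; apply/eqP.
have ik : (i <= k)%N by rewrite -ltnS.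
rewrite subSn//.
rewrite -[in LHS]mulr_natr -[in RHS](mulr_natr (_ * _)).
have E1 : k.+2%:R * 'C(k.+1, i)%:R = i.+1%:R * 'C(k.+2, i.+1)%:R :> R.
  by rewrite -!natrM (mul_bin_diag k.+2).
have E2 : k.+1%:R * 'C(k, i)%:R = (k - i).+1%:R * 'C(k.+1, i)%:R :> R.
  by rewrite -!natrM (mul_bin_down k.+1) subSn.
have -> : ('C(k, i)%:R : R) = (k - i).+1%:R * (i.+1%:R * 'C(k.+2, i.+1)%:R / k.+2%:R) / k.+1%:R.
  apply: (@mulfI _ k.+1%:R); first by rewrite pnatr_eq0.
  rewrite E2 -E1; by field; rewrite ?(nat1r, =^~ natrD) !pnatr_eq0.
by field; rewrite ?(nat1r, =^~ natrD) !pnatr_eq0.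
Qed.

End binomial_bounds.

(** * Finite mixtures of walks and their compound Poisson approximation *)

Section finite_walk.
Variables (R : realType) (V : zmodType).
Local Notation sc := (@convop_scalar R V).

Variable C : R.
Hypothesis C0 : 0 < C.
Hypothesis smoothingC : smoothing_constant C.

Variables (K N : nat) (f : 'I_K -> nat -> R) (y : 'I_K -> V).
Hypothesis f_ge0 : forall m k, 0 <= f m k.
Hypothesis f_sum : forall m, \sum_(k < N) 2 * f m k = 1.

Let T m := symm_step N (f m) (y m).
Let sigma m := Num.sqrt (2 * \sum_(k < N) k.+1%:R ^+ 2 * f m k).

Definition mixed_walk (q : R) (p : 'I_K -> R) : convop R V :=
  sc q + \sum_m sc (p m) * symm_step N (f m) (y m).

Lemma op_bound_mixed_walk q p : 0 <= q -> (forall m, 0 <= p m) ->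
  \sum_m p m = 1 - q -> op_bound (mixed_walk q p) 1.
Proof.
move=> q0 p0 pq; have -> : (1 : R) = q + \sum_m p m by rewrite pq; ring.
apply: op_boundD; first exact: op_bound_pscalar.
apply: op_bound_sum => m; rewrite -[p m]mulr1; apply: op_boundM.
  by rewrite mulr1; exact: op_bound_pscalar.
exact: op_bound_symm_step.
Qed.

Lemma mixed_walkB1 q p : \sum_m p m = 1 - q ->
  mixed_walk q p - 1 = \sum_m sc (p m) * (T m - 1).
Proof.
move=> pq; have -> : \sum_m sc (p m) * (T m - 1) = \sum_m sc (p m) * T m - sc (\sum_m p m).
  by rewrite rmorph_sum -sumrB; apply: eq_bigr => m _; ring.
by rewrite pq rmorphB rmorph1 /mixed_walk; ring.
Qed.

(* Each pair of steps gets its own half of the atom [q] and half of the weights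
   [p i] and [p j], so that both smoothing factors are available at once. *)
Lemma op_bound_mixed_walk_sq q p (w : 'I_K -> R) k :
  0 < q -> (forall m, 0 < p m) -> \sum_m p m = 1 - q ->
  (forall m, 0 <= w m) -> (forall m, C * (1 + sigma m) / q ^+ 3 <= w m ^+ 2) ->
  op_bound ((mixed_walk q p - 1) ^+ 2 * mixed_walk q p ^+ k)
    (4 * (\sum_m w m) ^+ 2 / (k.+1%:R * k.+2%:R)).
Proof.
move=> q0 p0 pq w0 Cw.
pose al m := (q + p m) / 2.
pose X m := sc (p m / 2) * (T m - 1).
pose A m := sc (q / 2) + sc (p m / 2) * T m.
have al0 m : 0 < al m by rewrite divr_gt0// addr_gt0.
have qp1 m : q + p m <= 1.
  have : p m <= \sum_m p m by rewrite (bigD1 m)//= lerDl sumr_ge0// => i _; exact: ltW.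
  by rewrite pq; lra.
have XA m b : op_bound (X m * A m ^+ b) (w m * al m ^+ b.+1 / b.+1%:R).
  (* [A m] is [al m] times a lazy law whose atom 1 - r = q / (q + p m) is at least q, since q + p m
     <= 1. *)
  pose r := p m / (q + p m).
  have qpm0 : 0 < q + p m by rewrite addr_gt0.
  have r1 : 1 - r = q / (q + p m) by rewrite /r; field; exact: lt0r_neq0.
  have E1 : sc (p m / 2) = sc (al m) * sc r.
    by rewrite -rmorphM; congr sc; rewrite /al /r; field; exact: lt0r_neq0.
  have E2 : sc (q / 2) = sc (al m) * sc (1 - r).
    by rewrite -rmorphM r1; congr sc; rewrite /al /r; field; exact: lt0r_neq0.
  have -> : X m * A m ^+ b = sc (al m) ^+ b.+1 *
      (sc r * (T m - 1) * (sc (1 - r) + sc r * T m) ^+ b).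
    have -> : A m = sc (al m) * (sc (1 - r) + sc r * T m) by rewrite /A E1 E2; ring.
    by rewrite exprMn exprS /X E1; ring.
  have -> : w m * al m ^+ b.+1 / b.+1%:R = al m ^+ b.+1 * (w m / b.+1%:R) by ring.
  apply: op_boundM.
    by apply: op_boundX; apply: op_bound_pscalar; exact: ltW.
  apply: (op_bound_smoothed smoothingC) => //.
    rewrite /r divr_gt0//= ltr_pdivrMr// mul1r ltrDr//.
  rewrite (le_trans _ (Cw m))// ler_wpM2l//.
    by rewrite mulr_ge0 ?(ltW C0)// addr_ge0// sqrtr_ge0.
  rewrite lef_pV2 ?posrE ?exprn_gt0// ?r1 ?divr_gt0//.
  rewrite lerXn2r// ?nnegrE ?(ltW q0)//; first by rewrite divr_ge0// ltW.
  by rewrite ler_pdivlMr// ler_piMr// ltW.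
have pair i j : op_bound (X i * X j * mixed_walk q p ^+ k)
    (w i * w j / (k.+1%:R * k.+2%:R)).
  (* What is left of the weights after both halves are removed. If i = j, both come from the same
     weight and [c i] is 0. *)
  pose c m := p m - (m == i)%:R * (p m / 2) - (m == j)%:R * (p m / 2).
  have c0 m : 0 <= c m.
    rewrite /c; have := p0 m; case: (m == i); case: (m == j); rewrite ?mul1r ?mul0r; lra.
  pose H := \sum_m sc (c m) * T m.
  have delta_sum (M : nmodType) (u : 'I_K) (F : 'I_K -> M) :
      \sum_m (if m == u then F m else 0) = F u by rewrite -big_mkcond big_pred1_eq.
  have HE : mixed_walk q p = A i + (A j + H).
    have -> : H = \sum_m sc (p m) * T m - sc (p i / 2) * T i - sc (p j / 2) * T j.
      rewrite -(delta_sum _ i (fun m => sc (p m / 2) * T m)).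
      rewrite -(delta_sum _ j (fun m => sc (p m / 2) * T m)).
      rewrite -!sumrB; apply: eq_bigr => m _; rewrite /c !rmorphB !mulrBl.
      by case: (m == i); case: (m == j); rewrite ?mul1r ?mul0r ?rmorph0 ?mul0r.
    rewrite /mixed_walk /A.
    have {1}-> : q = q / 2 + q / 2 by lra.
    by rewrite rmorphD; ring.
  pose eta := \sum_m c m.
  (* The masses sum to 1, so the powers in [op_bound_binomial2] disappear. *)
  have etaE : al i + (al j + eta) = 1.
    have -> : eta = \sum_m p m - p i / 2 - p j / 2.
      rewrite -(delta_sum _ i (fun m => p m / 2)).
      rewrite -(delta_sum _ j (fun m => p m / 2)).
      rewrite -!sumrB; apply: eq_bigr => m _; rewrite /c.
      by case: (m == i); case: (m == j); rewrite ?mul1r ?mul0r.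
    by rewrite pq /al; lra.
  have eta0 : 0 <= eta by apply: sumr_ge0.
  have hH : op_bound H eta.
    apply: op_bound_sum => m; rewrite -[c m]mulr1; apply: op_boundM.
      by rewrite mulr1; exact: op_bound_pscalar.
    exact: op_bound_symm_step.
  have aleta0 : 0 <= al j + eta by rewrite addr_ge0// ltW.
  have := op_bound_binomial2 k (w0 i) (w0 j) (ltW (al0 i)) aleta0 (XA i)
    (fun b => op_bound_binomial b (w0 j) (ltW (al0 j)) eta0 (XA j) hH).
  by rewrite -HE etaE expr1n mulr1.
have -> : (mixed_walk q p - 1) ^+ 2 * mixed_walk q p ^+ k =
    \sum_i \sum_j sc 4 * (X i * X j * mixed_walk q p ^+ k).
  rewrite mixed_walkB1//.
  have -> : \sum_m sc (p m) * (T m - 1) = sc 2 * \sum_m X m.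
    rewrite mulr_sumr; apply: eq_bigr => m _; rewrite /X mulrA -rmorphM.
    by congr (sc _ * _); lra.
  have -> : sc 4 = sc 2 * sc 2 by rewrite -rmorphM -natrM.
  rewrite exprMn !expr2 big_distrlr/= mulr_sumr mulr_suml.
  apply: eq_bigr => i _; rewrite mulr_sumr mulr_suml.
  by apply: eq_bigr => j _; ring.
rewrite expr2 big_distrlr/= mulr_sumr mulr_suml.
apply: op_bound_sum => i; rewrite mulr_sumr mulr_suml; apply: op_bound_sum => j.
rewrite -(mulrA 4); apply: op_boundM; last exact: pair.
by apply: op_bound_pscalar; rewrite ler0n.
Qed.

(** Applying the geometric sum twice gives [U] as a double sum of powers of 1 + Z; it has at most
    s^2 terms, each of norm at most 1. *)
Let taylor_second (Z : convop R V) s : exists2 U : convop R V,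
  (1 + Z) ^+ s = 1 + Z *+ s + Z ^+ 2 * U &
  (op_bound (1 + Z) 1 -> op_bound U (s%:R ^+ 2)).
Proof.
have S1 n : (1 + Z) ^+ n = 1 + Z * \sum_(i < n) (1 + Z) ^+ i.
  have := subrX1 (1 + Z) n; have -> : 1 + Z - 1 = Z by ring.
  by move=> <-; ring.
exists (\sum_(j < s) \sum_(i < j) (1 + Z) ^+ i).
  elim: s => [|s IH]; first by rewrite mulr0n big_ord0 mulr0 !addr0 expr0.
  rewrite big_ord_recr/= exprS mulrDl mul1r {2}S1 IH mulrSr; ring.
move=> G1; have -> : s%:R ^+ 2 = \sum_(j < s) s%:R :> R.
  by rewrite sumr_const card_ord expr2 mulr_natl.
apply: op_bound_sum => j; apply: (@op_bound_le _ _ _ (\sum_(i < j) 1)).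
  by rewrite sumr_const card_ord ler_nat ltnW.
by apply: op_bound_sum => i; rewrite -[X in op_bound _ X](expr1n R i); exact: op_boundX.
Qed.

(* 1 + (F - 1) / s is again a lazy mixed walk, with more mass at 0, and its
   (s n)-th power tends to exp (n (F - 1)) as s grows. In the telescoping sum of
   F^n - G^n either F or G occurs at least n / 2 times. *)
Theorem finite_walk_compound_poisson q p (w : 'I_K -> R) n s :
  0 < q < 1 -> (forall m, 0 < p m) -> \sum_m p m = 1 - q ->
  (forall m, 0 <= w m) -> (forall m, C * (1 + sigma m) / q ^+ 3 <= w m ^+ 2) ->
  (0 < n)%N -> (0 < s)%N ->
  op_bound (mixed_walk q p ^+ n -
            (1 + sc s%:R^-1 * (mixed_walk q p - 1)) ^+ (s * n))
    (16 * (\sum_m w m) ^+ 2 / n%:R).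
Proof.
move=> /andP[q0 q1] p0 pq w0 Cw n0 s0.
have s0' : 0 < s%:R :> R by rewrite ltr0n.
have s1 : 1 <= s%:R :> R by rewrite ler1n.
have n0' : 0 < n%:R :> R by rewrite ltr0n.
set F := mixed_walk q p; set Z := sc s%:R^-1 * (F - 1).
pose q' := 1 - (1 - q) / s%:R; pose p' m := p m / s%:R.
have pq' : \sum_m p' m = 1 - q' by rewrite /p' -mulr_suml pq /q'; ring.
have p0' m : 0 < p' m by rewrite divr_gt0.
have qq' : q <= q'.
  have : (1 - q) / s%:R <= 1 - q by rewrite ler_pdivrMr// ler_peMr// subr_ge0 ltW.
  by rewrite /q'; lra.
have q0' : 0 < q' by exact: lt_le_trans qq'.
have GE : mixed_walk q' p' = 1 + Z.
  apply: (addIr (- 1)); rewrite mixed_walkB1// addrAC subrr add0r /Z mixed_walkB1//.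
  rewrite mulr_sumr; apply: eq_bigr => m _; rewrite mulrA -rmorphM.
  by rewrite [_^-1 * _]mulrC.
have Cw' m : C * (1 + sigma m) / q' ^+ 3 <= w m ^+ 2.
  rewrite (le_trans _ (Cw m))// ler_wpM2l//.
    by rewrite mulr_ge0 ?(ltW C0)// addr_ge0// sqrtr_ge0.
  by rewrite lef_pV2 ?posrE ?exprn_gt0// lerXn2r ?nnegrE ?(ltW q0) ?(ltW q0').
set W := \sum_m w m.
have W0 : 0 <= W ^+ 2 by exact: sqr_ge0.
have W4 : 0 <= 4 * W ^+ 2 by apply: mulr_ge0.
have W16 : 0 <= 16 * W ^+ 2 by apply: mulr_ge0.
have F1 : op_bound F 1 by apply: op_bound_mixed_walk => //; [exact: ltW|move=> m; exact: ltW].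
have G1 : op_bound (1 + Z) 1.
  by rewrite -GE; apply: op_bound_mixed_walk => //; [exact: ltW|move=> m; exact: ltW].
have [U UE /(_ G1) HU] := taylor_second Z s.
(* The first-order terms cancel, so F - (1 + Z)^s is only the second-order remainder. *)
have Zs : Z *+ s = F - 1.
  rewrite /Z -mulrnAl -rmorphMn/= -mulr_natr mulVf ?lt0r_neq0// rmorph1 mul1r//.
have FG : F - (1 + Z) ^+ s = - (Z ^+ 2 * U) by rewrite UE Zs; ring.
have Hterm (k : 'I_n) : op_bound (F ^+ (n.-1 - k) * ((1 + Z) ^+ s) ^+ k * (Z ^+ 2 * U))
    (16 * W ^+ 2 / n%:R ^+ 2).
  have kn : (k <= n.-1)%N by rewrite -ltnS prednK.
  (* The s^2 in the bound on [U] is cancelled by (s k)^-2 when the power of 1 + Z does the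
     smoothing, and by the s^-2 contained in Z^2 when the power of F does. *)
  have [nk|nk] := leqP n (2 * k).
    have k0 : (0 < k)%N by rewrite lt0n; apply/negP => /eqP k0; move: nk n0; rewrite k0 muln0; case: (n).
    have HG := op_bound_mixed_walk_sq (s * k) q0' p0' pq' w0 Cw'.
    rewrite GE [1 + Z]addrC addrK [Z + 1]addrC in HG.
    have -> : F ^+ (n.-1 - k) * ((1 + Z) ^+ s) ^+ k * (Z ^+ 2 * U) =
      F ^+ (n.-1 - k) * U * (Z ^+ 2 * (1 + Z) ^+ (s * k)) by rewrite exprM; ring.
    apply: op_bound_le (op_boundM (op_boundM (op_boundX _ F1) HU) HG).
    rewrite expr1n mul1r -/W.
    have k0' : 0 < k%:R :> R by rewrite ltr0n.
    have nk' : n%:R <= 2 * k%:R :> R by rewrite -natrM ler_nat.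
    apply: (@le_trans _ _ (s%:R ^+ 2 * (4 * W ^+ 2 / ((s * k)%:R * (s * k)%:R)))).
      rewrite ler_wpM2l ?sqr_ge0// (ler_wpM2l W4)// lef_pV2 ?posrE ?mulr_gt0 ?ltr0n ?muln_gt0 ?s0//.
      by rewrite ler_pM// ler_nat// ltnW.
    have -> : s%:R ^+ 2 * (4 * W ^+ 2 / ((s * k)%:R * (s * k)%:R)) = 16 * W ^+ 2 / (2 * k%:R) ^+ 2.
      by rewrite natrM; field; rewrite !lt0r_neq0.
    rewrite (ler_wpM2l W16)// lef_pV2 ?posrE ?exprn_gt0 ?mulr_gt0//.
    by rewrite lerXn2r// nnegrE ?mulr_ge0// ltW.
  set a := (n.-1 - k)%N.
  have na : (n <= 2 * a.+1)%N.
    have na0 : (k + a).+1 = n by rewrite subnKC// prednK.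
    have ka : (k <= a)%N by rewrite -ltnS -(ltn_add2l k) addnn -mul2n addnS na0.
    by rewrite -[X in (X <= _)%N]na0 mul2n -addnn addnS ltnS leq_add2r leqW.
  have HF := op_bound_mixed_walk_sq a q0 p0 pq w0 Cw.
  have -> : F ^+ a * ((1 + Z) ^+ s) ^+ k * (Z ^+ 2 * U) =
    sc (s%:R^-1) ^+ 2 * U * ((1 + Z) ^+ s) ^+ k * ((F - 1) ^+ 2 * F ^+ a).
    by rewrite {2}/Z; ring.
  have V0 : 0 <= s%:R^-1 :> R by rewrite invr_ge0.
  have HV : op_bound (sc s%:R^-1) s%:R^-1 by exact: op_bound_pscalar.
  apply: op_bound_le (op_boundM (op_boundM (op_boundM
    (op_boundX 2 HV) HU) (op_boundX k (op_boundX s G1))) HF).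
  rewrite !expr1n mulr1 -exprMn mulVf ?lt0r_neq0// expr1n mul1r -/W.
  have na' : n%:R <= 2 * a.+1%:R :> R by rewrite -natrM ler_nat.
  apply: (@le_trans _ _ (4 * W ^+ 2 / (a.+1%:R * a.+1%:R))).
    rewrite (ler_wpM2l W4)// lef_pV2 ?posrE ?mulr_gt0//.
    by rewrite ler_pM2l// ler_nat.
  have -> : 4 * W ^+ 2 / (a.+1%:R * a.+1%:R) = 16 * W ^+ 2 / (2 * a.+1%:R) ^+ 2.
    have := ltr0Sn R a; move: (a.+1%:R) => b b0.
    by field; rewrite !lt0r_neq0.
  rewrite (ler_wpM2l W16)// lef_pV2 ?posrE ?exprn_gt0 ?mulr_gt0//.
  by rewrite lerXn2r// nnegrE ?mulr_ge0// ltW.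
rewrite exprM subrXX FG mulNr mulrC mulr_suml; apply: op_boundN.
have -> : 16 * W ^+ 2 / n%:R = \sum_(k < n) 16 * W ^+ 2 / n%:R ^+ 2.
  by rewrite sumr_const card_ord -mulr_natr; field; exact: lt0r_neq0.
apply: op_bound_sum => k; have := Hterm k; rewrite -subn1 subnAC subn1 -subnS.
by apply.
Qed.

End finite_walk.

(** * Reduction of signed measures to convolution operators *)

Section bounded_integral.
Context d (T : measurableType d) (R : realType).
Variable mu : {finite_measure set T -> \bar R}.
Implicit Types (f g : T -> R) (c : R).

Lemma bounded_integrable f c : measurable_fun setT f ->
  (forall x, `|f x| <= c) -> mu.-integrable setT (EFin \o f).
Proof.
move=> mf fc; apply: measurable_bounded_integrable => //.
  by rewrite ltey_eq fin_num_measure.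
exists c; split; rewrite ?num_real// => x cx y _ /=.
by rewrite (le_trans (fc y))// ltW.
Qed.

Lemma bounded_integral_le f c : measurable_fun setT f ->
  (forall x, `|f x| <= c) -> `|\int[mu]_x f x| <= c * fine (mu setT).
Proof.
move=> mf fc; have fi := bounded_integrable mf fc.
rewrite (le_trans (le_normr_Rintegral _ fi))// -(Rintegral_cst mu measurableT c).
apply: le_Rintegral => //.
- by have := integrable_norm fi.
- exact: (@bounded_integrable (cst c) `|c|).
Qed.

End bounded_integral.

(** * Integration against signed measures *)

Section charge_integral.
Context (R : realType).

Lemma charge_decomp d (T : measurableType d) (M : {charge set T -> \bar R}) A :
  measurable A -> M A = (charge_pos M A - charge_neg M A)%E.
Proof.
move=> mA; rewrite [LHS](jordan_decomp (proj2_sig (hahn_sets M)) mA).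
by rewrite /cadd/= /cscale/= mulN1e.
Qed.

(** [\x] is defined by integrating over the first factor. The order is exchanged because
    [charge_conv_pow] puts the new factor second. *)
Lemma product_measure_ysection d1 d2 (T1 : measurableType d1)
    (T2 : measurableType d2) (m1 : {finite_measure set T1 -> \bar R})
    (m2 : {finite_measure set T2 -> \bar R}) E : measurable E ->
  (m1 \x m2)%E E = (\int[m2]_y fine (m1 (ysection E y)))%:E.
Proof.
move=> mE.
rewrite (@product_measure_unique _ _ _ _ _ m1 m2 (m1 \x^ m2)%E)//; last first.
  by move=> A B mA mB; exact: product_measure2E.
have mm : measurable_fun setT (fun y => fine (m1 (ysection E y))).
  exact: measurableT_comp (@fine_measurable R _ measurableT) (measurable_fun_ysection _ mE).
have bm y : `|fine (m1 (ysection E y))| <= fine (m1 setT).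
  rewrite ger0_norm ?fine_ge0//; apply: fine_le; rewrite ?fin_num_measure//.
  - exact: measurable_ysection.
  - by apply: le_measure; rewrite ?inE//; exact: measurable_ysection.
rewrite /product_measure2 /Rintegral fineK; last first.
  by apply: integrable_fin_num => //; exact: bounded_integrable mm bm.
apply: eq_integral => y _ /=; rewrite fineK// fin_num_measure//.
exact: measurable_ysection.
Qed.

Definition charge_integral d (T : measurableType d)
    (M : {charge set T -> \bar R}) (f : T -> R) : R :=
  \int[charge_pos M]_x f x - \int[charge_neg M]_x f x.

Lemma measurable_charge_ysection d1 d2 (T1 : measurableType d1)
    (T2 : measurableType d2) (M : {charge set T1 -> \bar R})
    (E : set (T1 * T2)) : measurable E ->
  measurable_fun setT (fun y => fine (M (ysection E y))).
Proof.
move=> mE.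
have -> : (fun y => fine (M (ysection E y))) =
    (fun y => fine (charge_pos M (ysection E y)) - fine (charge_neg M (ysection E y))).
  apply/funext => y; have my : measurable (ysection E y) by exact: measurable_ysection.
  by rewrite charge_decomp// fineB// fin_num_measure.
by apply: measurable_funB; exact: measurableT_comp (@fine_measurable R _ measurableT) (measurable_fun_ysection _ mE).
Qed.

Lemma product_charge_ysection d1 d2 (T1 : measurableType d1)
    (T2 : measurableType d2) (M : {charge set T1 -> \bar R})
    (N : {charge set T2 -> \bar R}) E : measurable E ->
  product_charge M N E =
  (charge_integral N (fun y => fine (M (ysection E y))))%:E.
Proof.
move=> mE.
have mS (mu : {finite_measure set T1 -> \bar R}) :
    measurable_fun setT (fun y => fine (mu (ysection E y))).
  exact: measurableT_comp (@fine_measurable R _ measurableT) (measurable_fun_ysection _ mE).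
have bS (mu : {finite_measure set T1 -> \bar R}) y :
    `|fine (mu (ysection E y))| <= fine (mu setT).
  rewrite ger0_norm ?fine_ge0//; apply: fine_le; rewrite ?fin_num_measure//.
  - exact: measurable_ysection.
  - by apply: le_measure; rewrite ?inE//; exact: measurable_ysection.
have iS (mu : {finite_measure set T1 -> \bar R})
    (nu : {finite_measure set T2 -> \bar R}) :
    nu.-integrable setT (EFin \o (fun y => fine (mu (ysection E y)))).
  exact: bounded_integrable (mS mu) (bS mu).
have decomp : (fun y => fine (M (ysection E y))) =
    (fun y => fine (charge_pos M (ysection E y)) - fine (charge_neg M (ysection E y))).
  apply/funext => y; have my : measurable (ysection E y) by exact: measurable_ysection.
  by rewrite charge_decomp// fineB// fin_num_measure.
have RB (nu : {finite_measure set T2 -> \bar R}) :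
    \int[nu]_y (fine (charge_pos M (ysection E y)) - fine (charge_neg M (ysection E y))) =
    \int[nu]_y fine (charge_pos M (ysection E y)) -
    \int[nu]_y fine (charge_neg M (ysection E y)).
  by apply: RintegralB => //; exact: iS.
rewrite /charge_integral decomp !RB.
transitivity ((charge_pos M \x charge_pos N)%E E + (charge_neg M \x charge_neg N)%E E -
  ((charge_pos M \x charge_neg N)%E E + (charge_neg M \x charge_pos N)%E E))%E; first by [].
rewrite !product_measure_ysection// -!EFinD; congr (_%:E).
by ring.
Qed.

Lemma charge_conv_integral n (P M : {charge set 'rV[R]_n -> \bar R}) B :
  measurable B -> charge_conv P M B =
  (charge_integral M (fun y => fine (P [set x | B (x + y)])))%:E.
Proof.
move=> mB; have mE : measurable (@rV_add R n @^-1` B).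
  by rewrite -[X in measurable X]setTI; exact: measurable_rV_add.
rewrite [LHS]product_charge_ysection//; congr ((charge_integral M _)%:E).
apply/funext => y; congr (fine (P _)).
by apply/seteqP; split => x; rewrite /ysection/= inE.
Qed.

(** Equal measures have equal integrals of non-negative functions. Adding [c] makes f non-negative,
    and the correction cancels because the total masses agree. *)
Lemma Rintegral_mixture d (T : measurableType d) n1 n2
    (a1 a2 : nat -> R) (m1 m2 : nat -> {finite_measure set T -> \bar R})
    (f : T -> R) c :
  (forall i, 0 <= a1 i) -> (forall i, 0 <= a2 i) ->
  (forall A, measurable A ->
    (\sum_(i < n1) (a1 i)%:E * m1 i A = \sum_(i < n2) (a2 i)%:E * m2 i A)%E) ->
  measurable_fun setT f -> (forall x, `|f x| <= c) ->
  \sum_(i < n1) a1 i * (\int[m1 i]_x f x) =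
  \sum_(i < n2) a2 i * (\int[m2 i]_x f x).
Proof.
move=> a10 a20 m12 mf fc.
have shifted (mu : {finite_measure set T -> \bar R}) :
    \int[mu]_x f x = \int[mu]_x (f x + c) - c * fine (mu setT).
  rewrite -[c * _](Rintegral_cst mu measurableT c) -RintegralB//.
  - by apply: eq_Rintegral => x _; rewrite addrK.
  - apply: (@bounded_integrable _ _ _ mu _ (c + c)).
      by apply: measurable_funD => //; exact: measurable_cst.
    move=> x; rewrite (le_trans (ler_normD _ _))// lerD// ger0_norm//.
    exact: le_trans (fc x).
  - exact: (@bounded_integrable _ _ _ mu (cst c) `|c|).
have c0 x : 0 <= f x + c.
  by have := fc x; rewrite ler_norml => /andP[h _]; lra.
have mfc : measurable_fun setT (fun x => (f x + c)%:E).
  apply/measurable_EFinP; apply: measurable_funD => //; exact: measurable_cst.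
have mix n (a : nat -> R) (m : nat -> {finite_measure set T -> \bar R}) (a0 : forall i, 0 <= a i) :
    (\int[msum (fun i => mscale (NngNum (a0 i)) (m i)) n]_x (f x + c)%:E =
    (\sum_(i < n) a i * (\int[m i]_x (f x + c)))%:E)%E.
  rewrite ge0_integral_measure_sum//; last by move=> x _; rewrite lee_fin.
  rewrite -sumEFin; apply: eq_bigr => i _.
  rewrite ge0_integral_mscale//=; last by move=> x _; rewrite lee_fin.
  rewrite EFinM /Rintegral fineK//.
  apply: integrable_fin_num => //; apply: (@bounded_integrable _ _ _ (m i) _ (c + c)).
    by apply: measurable_funD => //; exact: measurable_cst.
  move=> x; rewrite (le_trans (ler_normD _ _))// lerD// ger0_norm//.
  exact: le_trans (fc x).
have Ei : \sum_(i < n1) a1 i * (\int[m1 i]_x (f x + c)) =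
    \sum_(i < n2) a2 i * (\int[m2 i]_x (f x + c)).
  apply: EFin_inj; rewrite -(mix _ _ _ a10) -(mix _ _ _ a20).
  by apply: eq_measure_integral => A mA _; exact: m12.
have ET : \sum_(i < n1) a1 i * fine (m1 i setT) = \sum_(i < n2) a2 i * fine (m2 i setT).
  apply: EFin_inj; rewrite -!sumEFin.
  have := m12 _ measurableT; congr (_ = _); apply: eq_bigr => i _;
    by rewrite EFinM fineK// fin_num_measure.
have split_sum n (a : nat -> R) (m : nat -> {finite_measure set T -> \bar R}) :
    \sum_(i < n) a i * (\int[m i]_x f x) =
    \sum_(i < n) a i * (\int[m i]_x (f x + c)) - c * \sum_(i < n) a i * fine (m i setT).
  rewrite mulr_sumr -sumrB; apply: eq_bigr => i _; rewrite shifted; ring.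
by rewrite !split_sum Ei ET.
Qed.

Lemma Rintegral_dirac d (T : measurableType d) (v : T) (f : T -> R) :
  measurable_fun setT f -> \int[\d_v]_x f x = f v.
Proof.
move=> mf; rewrite /Rintegral integral_dirac//; last exact/measurable_EFinP.
by rewrite diracT mul1e.
Qed.

(** F may charge v, so a F and b times the Dirac mass need not be the Jordan parts of M. Moving the
    negative terms across gives an identity between measures, to which [Rintegral_mixture]
    applies. *)
Lemma charge_integral_affine d (T : measurableType d)
    (M : {charge set T -> \bar R}) (F : {finite_measure set T -> \bar R})
    (a b : R) (v : T) (f : T -> R) c : 0 <= a -> 0 <= b ->
  (forall A, measurable A -> M A = (a%:E * F A - b%:E * \d_v A)%E) ->
  measurable_fun setT f -> (forall x, `|f x| <= c) ->
  charge_integral M f = a * (\int[F]_x f x) - b * f v.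
Proof.
move=> a0 b0 MF mf fc.
pose dv : {finite_measure set T -> \bar R} := \d_v.
pose a1 (i : nat) := if i is 0%N then 1 else b.
pose a2 (i : nat) := if i is 0%N then a else 1.
pose m1 (i : nat) := if i is 0%N then charge_pos M else dv.
pose m2 (i : nat) := if i is 0%N then F else charge_neg M.
have a10 i : 0 <= a1 i by case: i.
have a20 i : 0 <= a2 i by case: i.
have := @Rintegral_mixture _ _ 2 2 a1 a2 m1 m2 f c a10 a20.
rewrite !big_ord_recr !big_ord0 /= !add0r !mul1r.
rewrite Rintegral_dirac// => H.
rewrite /charge_integral; apply/eqP; rewrite subr_eq -[X in _ == X]addrAC -[X in _ == X - _]H ?addrK//.
move=> A mA.
have -> : (\sum_(i < 2) (a1 i)%:E * m1 i A = charge_pos M A + b%:E * \d_v A)%E.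
  by rewrite !big_ord_recr !big_ord0 /= add0e mul1e.
have -> : (\sum_(i < 2) (a2 i)%:E * m2 i A = a%:E * F A + charge_neg M A)%E.
  by rewrite !big_ord_recr !big_ord0 /= add0e mul1e.
have := MF A mA; rewrite charge_decomp//.
have : charge_pos M A \is a fin_num by rewrite fin_num_measure.
have : charge_neg M A \is a fin_num by rewrite fin_num_measure.
have : F A \is a fin_num by rewrite fin_num_measure.
rewrite diracE.
move: (charge_pos M A) (charge_neg M A) (F A) => [x| |] [y| |] [z| |]// _ _ _.
rewrite -!EFinM -!EFinN -!EFinD => -[xyz]; congr (_%:E); move: xyz; lra.
Qed.

End charge_integral.

(** * Evaluation of convolution operators *)

Section convop_extra.
Variables (R : realType) (V : zmodType).
Implicit Types (T : convop R V) (h g : V -> R).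

Lemma convop_sumE I (r : seq I) (F : I -> convop R V) h x :
  (\sum_(i <- r) F i) h x = \sum_(i <- r) F i h x.
Proof.
elim/big_rec2: _ => [|i u A _ <-]; last by [].
by rewrite -[0]/(convop_scalar V 0) convop_scalarE mul0r.
Qed.

Lemma convop_subE T h g x : T (fun z => h z - g z) x = T h x - T g x.
Proof.
have -> : (fun z => h z - g z) = (fun z => -1 * g z + h z).
  by apply/funext => z; rewrite mulN1r addrC.
by rewrite convop_linear mulN1r addrC.
Qed.

Lemma convop_translate T h z : T (fun y => h (y + z)) 0 = T h z.
Proof.
have := congr1 (fun u => u 0) (convop_shift T z h); rewrite /= /shift add0r => <-.
by [].
Qed.

Lemma symm_stepE N f y h x : symm_step N f y h x =
  \sum_(k < N) f k * (h (x + y *+ k.+1) + h (x - y *+ k.+1)).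
Proof. by rewrite /symm_step convop_sumE. Qed.

Lemma mixed_walkE K N (f : 'I_K -> nat -> R) y q p h x :
  mixed_walk N f y q p h x =
  q * h x + \sum_m p m * symm_step N (f m) (y m) h x.
Proof. by rewrite /mixed_walk convop_addE convop_sumE. Qed.

End convop_extra.

(** * Convolution powers of a F - b I and their operator approximation *)

Section charge_powers.
Variables (R : realType) (n : nat).
Notation V := 'rV[R]_n.

Lemma measurable_translate (B : set V) z : measurable B ->
  measurable [set x | B (x + z)].
Proof.
move=> mB; have mE : measurable (@rV_add R n @^-1` B).
  by rewrite -[X in measurable X]setTI; exact: measurable_rV_add.
have := measurable_ysection z mE.
by congr measurable; apply/seteqP; split => x; rewrite /ysection/= inE.
Qed.

Lemma measurable_charge_translate (M : {charge set V -> \bar R}) (B : set V) :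
  measurable B -> measurable_fun setT (fun z : V => fine (M [set x | B (x + z)])).
Proof.
move=> mB; have mE : measurable (@rV_add R n @^-1` B).
  by rewrite -[X in measurable X]setTI; exact: measurable_rV_add.
have := measurable_charge_ysection M mE; congr measurable_fun.
apply/funext => z; congr (fine (M _)).
by apply/seteqP; split => x; rewrite /ysection/= inE.
Qed.

Variables (F : probability V R) (M : {charge set V -> \bar R}) (a b : R).
Hypothesis a0 : 0 <= a.
Hypothesis b0 : 0 <= b.
Hypothesis MF : forall A, measurable A -> M A = (a%:E * F A - b%:E * \d_(0%R : V) A)%E.

Variables (T : convop R V) (eps : R).
Hypothesis TF : forall (f : V -> R) (c : R), measurable_fun setT f ->
  (forall x, `|f x| <= c) -> `|\int[F]_x f x - T f 0| <= eps * c.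
Hypothesis T1 : op_bound T 1.

Let D : convop R V := convop_scalar V a * T - convop_scalar V b.
Let rho := a + b.

Let D_bound : op_bound D rho.
Proof.
apply: op_boundD; last by apply: op_boundN; exact: op_bound_pscalar.
by rewrite -[a]mulr1; apply: op_boundM => //; rewrite mulr1; exact: op_bound_pscalar.
Qed.

(** Induction on j, for all translates of B at once, replacing one factor at a time. The case a = 1,
    b = 0 serves F itself, the case a = b = n serves n (F - I). *)
Lemma charge_conv_pow_approx (B : set V) j z : measurable B ->
  `|fine (charge_conv_pow M j [set x | B (x + z)])| <= rho ^+ j /\
  `|fine (charge_conv_pow M j [set x | B (x + z)]) - (D ^+ j) (\1_B) z|
     <= j%:R * rho ^+ j * eps.
Proof.
move=> mB; have rho0 : 0 <= rho by rewrite addr_ge0.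
have translate2 (y z' : V) : [set x | [set x' | B (x' + z')] (x + y)] = [set x | B (x + (y + z'))].
  by apply/funext => x /=; rewrite addrA.
elim: j z => [|j IH] z.
  have -> : charge_conv_pow M 0 [set x | B (x + z)] = (\1_B z)%:E.
    rewrite /= /charge_delta0 /charge_of_finite_measure diracE !indicE.
    by congr ((nat_of_bool _)%:R%:E); apply/idP/idP; rewrite !inE/= add0r.
  rewrite !expr0 mul0r mul0r; split.
    by rewrite /= indicE; case: (_ \in _); rewrite ?normr1 ?normr0.
  by rewrite /= mul1r subrr normr0.
set g := fun z => fine (charge_conv_pow M j [set x | B (x + z)]).
have mgz : measurable_fun setT (fun y : V => g (y + z)).
  have := measurable_charge_translate (charge_conv_pow M j) (measurable_translate z mB).
  by congr measurable_fun; apply/funext => y; rewrite translate2.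
have gb y : `|g y| <= rho ^+ j by have [] := IH y.
have -> : fine (charge_conv_pow M j.+1 [set x | B (x + z)]) =
    a * \int[F]_y g (y + z) - b * g z.
  rewrite [charge_conv_pow _ _]/= charge_conv_integral; last exact: measurable_translate.
  have <- : charge_integral M (fun y : V => g (y + z)) = a * \int[F]_y g (y + z) - b * g z.
    by rewrite (charge_integral_affine a0 b0 MF mgz (fun y => gb (y + z)))/= add0r.
  by rewrite [LHS]/=; congr charge_integral; apply/funext => y; rewrite translate2.
have Fb : `|\int[F]_y g (y + z)| <= rho ^+ j.
  rewrite (le_trans (bounded_integral_le F mgz (fun y => gb (y + z))))//.
  have F1 : fine (F [set: V]) = 1 := congr1 fine (@probability_setT _ _ _ F).
  by move: F1 => /= ->; rewrite mulr1.
split.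
  rewrite (le_trans (ler_normB _ _))// !normrM (ger0_norm a0) (ger0_norm b0).
  by rewrite exprS mulrDl lerD// ler_wpM2l.
have -> : (D ^+ j.+1) (\1_B) z = D ((D ^+ j) (\1_B)) z by rewrite exprS.
have DE h : D h z = a * T h z - b * h z.
  by rewrite /D convop_addE convop_oppE convop_mulE !convop_scalarE.
(* The first term replaces F by [T] in the new factor; the second carries the earlier error through
   [D]. *)
have -> : a * \int[F]_y g (y + z) - b * g z - D ((D ^+ j) (\1_B)) z =
    a * (\int[F]_y g (y + z) - T g z) + D (fun x => g x - (D ^+ j) (\1_B) x) z.
  by rewrite convop_subE (DE g); ring.
rewrite (le_trans (ler_normD _ _))//.
have e1 : `|a * (\int[F]_y g (y + z) - T g z)| <= rho ^+ j.+1 * eps.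
  rewrite normrM (ger0_norm a0) -convop_translate exprS -mulrA.
  apply: ler_pM => //; first by rewrite /rho lerDl.
  by rewrite mulrC; apply: TF => // y; exact: gb.
have e2 : `|D (fun x => g x - (D ^+ j) (\1_B) x) z| <= rho * (j%:R * rho ^+ j * eps).
  by apply: D_bound => x; have [] := IH x.
rewrite (le_trans (lerD e1 e2))// -natr1 exprS le_eqVlt; apply/orP; left; apply/eqP.
by ring.
Qed.

End charge_powers.

(** * Integrals against a mixture *)

Section mixtures.
Context (R : realType).

Lemma Rintegral_probability_mixture d (T : measurableType d) K (F : probability T R) (q : R)
    (p : 'I_K -> R) (Fm : 'I_K -> probability T R) (v : T) (f : T -> R) c :
  0 <= q -> (forall m, 0 <= p m) ->
  (forall B, measurable B ->
    F B = (q%:E * \d_v B + \sum_(m < K) (p m)%:E * Fm m B)%E) ->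
  measurable_fun setT f -> (forall x, `|f x| <= c) ->
  \int[F]_x f x = q * f v + \sum_m p m * \int[Fm m]_x f x.
Proof.
move=> q0 p0 FE mf fc.
pose F' : {finite_measure set T -> \bar R} := F.
pose dv : {finite_measure set T -> \bar R} := \d_v.
(* [Rintegral_mixture] takes families indexed by [nat]: index 0 is the Dirac mass, and indices
   beyond K get weight 0. *)
pose a (i : nat) : R := if i is j.+1 then oapp p 0 (insub j) else q.
pose m (i : nat) : {finite_measure set T -> \bar R} :=
  if i is j.+1 then oapp (fun k => (Fm k : {finite_measure set T -> \bar R})) F' (insub j) else dv.
have a0 i : 0 <= a i by case: i => // j; rewrite /a; case: insub.
have := @Rintegral_mixture R _ T 1 K.+1 (fun=> 1) a (fun=> F') m f c (fun=> ler01) a0.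
rewrite big_ord_recr big_ord0/= add0r mul1r => ->//.
  rewrite big_ord_recl/= Rintegral_dirac//; congr (_ + _).
  by apply: eq_bigr => i _; rewrite /a /m/= add0n/= valK.
move=> A mA; rewrite big_ord_recr big_ord0/= add0e mul1e FE// big_ord_recl/=.
congr (_ + _)%E.
by apply: eq_bigr => i _; rewrite /a /m/= add0n/= valK.
Qed.

End mixtures.

(** * Integrals approximated by finitely many atoms *)

Section discrete_approximation.
Context d (T : measurableType d) (R : realType) (P : probability T R).
Hypothesis mset1 : forall v : T, measurable [set v].

(** f and its restriction to the points of s differ by at most c, and only off s, a set of mass 1
    minus the sum of the atoms. *)
Lemma discrete_integral_approx (s : seq T) (f : T -> R) c : uniq s ->
  measurable_fun setT f -> (forall x, `|f x| <= c) ->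
  `|\int[P]_x f x - \sum_(v <- s) fine (P [set v]) * f v| <=
  c * (1 - \sum_(v <- s) fine (P [set v])).
Proof.
move=> us mf fc.
have P1 : fine (P [set: T]) = 1 by rewrite probability_setT.
have c0 : 0 <= c by apply: le_trans (fc point).
have simple (w : T -> R) (r : seq T) : [/\ measurable_fun setT (fun x => \sum_(v <- r) w v * \1_[set v] x),
    (exists C, forall x, `|\sum_(v <- r) w v * \1_[set v] x| <= C) &
    \int[P]_x (\sum_(v <- r) w v * \1_[set v] x) = \sum_(v <- r) fine (P [set v]) * w v].
  elim: r => [|v r [IH1 [C IH2] IH3]].
    split.
    - rewrite (_ : (fun x => _) = cst 0); first exact: measurable_cst.
      by apply/funext => x; rewrite big_nil.
    - by exists 0 => x; rewrite big_nil normr0.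
    - rewrite big_nil (@eq_Rintegral _ _ _ P setT (fun=> 0)); first by rewrite Rintegral_cst// mul0r.
      by move=> x _; rewrite big_nil.
  have ind : measurable_fun setT (fun x => w v * \1_[set v] x).
    by apply: measurable_funM; [exact: measurable_cst|exact: measurable_indic].
  have indb x : `|w v * \1_[set v] x| <= `|w v|.
    rewrite normrM ler_piMr//; rewrite indicE; case: (_ \in _); rewrite ?normr1 ?normr0//.
  have E x : \sum_(u <- v :: r) w u * \1_[set u] x = w v * \1_[set v] x + \sum_(u <- r) w u * \1_[set u] x.
    by rewrite big_cons.
  split.
  - by rewrite (funext E); exact: measurable_funD ind IH1.
  - exists (`|w v| + C) => x; rewrite E (le_trans (ler_normD _ _))// lerD//.
  - rewrite (eq_Rintegral _ (fun x _ => E x)) RintegralD//.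
    + rewrite IH3 big_cons; congr (_ + _).
      rewrite RintegralZl//; last first.
        have m1 : measurable_fun setT (\1_[set v] : T -> R) by exact: measurable_indic.
        apply: (bounded_integrable (c := 1) P m1) => x.
        by rewrite indicE; case: (_ \in _); rewrite ?normr1 ?normr0.
      by rewrite /Rintegral integral_indic// setIT mulrC.
    + exact: bounded_integrable ind indb.
    + exact: bounded_integrable IH1 IH2.
have [m1 [C1 b1] i1] := simple f s.
have [m2 [C2 b2] i2] := simple (fun=> 1) s.
have -> : \sum_(v <- s) fine (P [set v]) * f v = \int[P]_x (\sum_(v <- s) f v * \1_[set v] x).
  by rewrite i1.
have -> : \sum_(v <- s) fine (P [set v]) = \int[P]_x (\sum_(v <- s) 1 * \1_[set v] x).
  by rewrite i2; apply: eq_bigr => v _; rewrite mulr1.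
have if0 := bounded_integrable P mf fc.
have if1 := bounded_integrable P m1 b1.
have if2 := bounded_integrable P m2 b2.
have ic : P.-integrable setT (EFin \o cst (1 : R)).
  by apply: (@bounded_integrable _ _ _ P _ 1) => // x; rewrite normr1.
rewrite -RintegralB//.
have -> : 1 - \int[P]_x (\sum_(v <- s) 1 * \1_[set v] x) =
    \int[P]_x (1 - \sum_(v <- s) 1 * \1_[set v] x).
  by rewrite RintegralB// Rintegral_cst// P1 mulr1.
have ib : P.-integrable setT (EFin \o (fun x => 1 - \sum_(v <- s) 1 * \1_[set v] x)).
  exact: (integrableB measurableT ic if2).
rewrite -RintegralZl//.
have ia : P.-integrable setT (EFin \o (fun x => f x - \sum_(v <- s) f v * \1_[set v] x)).
  exact: (integrableB measurableT if0 if1).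
rewrite (le_trans (le_normr_Rintegral _ ia))//; apply: le_Rintegral => //.
- exact: integrable_norm ia.
- exact: (integrableZl measurableT c ib).
- move=> x _.
  have [xs|xs] := boolP (x \in s).
    have sE (w : T -> R) : \sum_(v <- s) w v * \1_[set v] x = w x.
      rewrite (bigD1_seq x)//= indicE mem_set// mulr1 big1 ?addr0// => v vx.
      by rewrite indicE memNset ?mulr0//= => xv; move: vx; rewrite xv eqxx.
    by rewrite !sE !subrr normr0 mulr0.
  have sE (w : T -> R) : \sum_(v <- s) w v * \1_[set v] x = 0.
    rewrite big_seq big1// => v vs.
    by rewrite indicE memNset ?mulr0//= => xv; move: xs; rewrite xv vs.
  by rewrite !sE !subr0 mulr1.
Qed.

End discrete_approximation.

(** * A set containing the topological support has full measure *)

Section support.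
Variables (R : realType) (n : nat).
Notation V := 'rV[R]_n.

Lemma measurable_set1_rV (v : V) : measurable [set v].
Proof.
rewrite -[X in measurable X]setCK; apply: measurableC; apply: rV_open_measurable.
apply: closed_openC; apply: accessible_closed_set1.
by apply: hausdorff_accessible; exact: norm_hausdorff.
Qed.

Lemma rat_approx_rV (x : V) (e : R) : 0 < e ->
  exists w : 'rV[rat]_n, ball (map_mx ratr w : V) e x.
Proof.
move=> e0.
have h i : {q : rat | `|ratr q - x ord0 i| < e}.
  apply: cid; have := @rat_in_itvoo R (x ord0 i - e) (x ord0 i + e).
  have -> : x ord0 i - e < x ord0 i + e by rewrite ltrD2l gtrN.
  move=> /(_ isT)[q]; rewrite in_itv/= => /andP[q1 q2]; exists q.
  by rewrite ltr_norml ltrBrDl q1 ltrBlDl.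
exists (\row_i sval (h i)); split => // i j.
by rewrite (ord1 i) !mxE /ball/=; exact: (svalP (h j)).
Qed.

(* R^n is second countable, so the complement of the support is a countable
   union of null balls. *)
Lemma msupp_full (P : probability V R) (L : set V) : measurable L ->
  msupp P `<=` L -> P L = 1%E.
Proof.
move=> mL PL.
pose box (w : 'rV[rat]_n * nat) : set V := ball (map_mx ratr w.1 : V) (w.2.+1%:R^-1).
have obox w : open (box w) by exact: ball_open.
(* Enumerates the rational balls of measure zero, with the empty set in place of the others. *)
pose B k := if unpickle k is Some w then
  (if P (box w) == 0%E then box w else set0) else set0.
have nB k : P.-negligible (B k).
  rewrite /B; case: (unpickle k) => [w|]; last exact: negligible_set0.
  case: ifPn => [/eqP P0|_]; last exact: negligible_set0.
  by exists (box w); split => //; exact: rV_open_measurable.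
have sub : ~` L `<=` \bigcup_k B k.
  move=> x Lx; have : ~ msupp P x by move=> /PL.
  move=> /existsNP[U /not_implyP[oU /not_implyP[Ux PU]]].
  have PU0 : P U = 0%E.
    apply/eqP; rewrite eq_le measure_ge0 andbT leNgt; exact/negP.
  have /nbhs_ballP[e /= e0 eU] := open_nbhs_nbhs (conj oU Ux).
  have e20 : 0 < e / 2 by rewrite divr_gt0.
  have [k _ ke] := near_infty_natSinv_lt (PosNum e20).
  have {}ke := ke k (leqnn k); rewrite /= in ke.
  have k0 : (0 < k.+1%:R^-1 :> R) by rewrite invr_gt0.
  have [w wx] := rat_approx_rV x k0.
  exists (pickle (w, k)) => //; rewrite /B pickleK.
  have boxU : box (w, k) `<=` U.
    move=> z /= wz; apply: eU; have := ball_triangle (ball_sym wx) wz.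
    by apply: le_ball; rewrite (splitr e) lerD// ltW.
  have -> : P (box (w, k)) = 0%E.
    apply/eqP; rewrite eq_le measure_ge0 andbT -PU0 le_measure ?inE//.
      exact: rV_open_measurable.
    exact: rV_open_measurable.
  by rewrite eqxx.
have : P (~` L) = 0%E.
  apply: measure_negligible; first exact: measurableC.
  by apply: negligibleS sub _; exact: negligible_bigcup.
rewrite probability_setC//.
have : P L \is a fin_num by rewrite fin_num_measure.
by case: (P L) => // r _ [] /eqP; rewrite subr_eq0 => /eqP <-.
Qed.

End support.

(** * Symmetric lattice laws and their truncation *)

Section lattice_law.
Variables (R : realType) (n : nat).
Notation V := 'rV[R]_n.
Variables (P : probability V R) (y : V).
Hypothesis y0 : y != 0.
Hypothesis supp_y : msupp P `<=` [set k%:~R *: y | k in [set k : int | k != 0]].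
Hypothesis sym_y : forall k, (0 < k)%N -> P [set k%:R *: y] = P [set - k%:R *: y].

Definition lattice_mass k : R := fine (P [set k.+1%:R *: y]).

Lemma lattice_mass_ge0 k : 0 <= lattice_mass k.
Proof. by rewrite fine_ge0. Qed.

Let massE k : P [set k.+1%:R *: y] = (lattice_mass k)%:E.
Proof. by rewrite fineK// fin_num_measure//; exact: measurable_set1_rV. Qed.

Let massNE k : P [set - k.+1%:R *: y] = (lattice_mass k)%:E.
Proof. by rewrite -sym_y. Qed.

Let scale_inj (a b : R) : a *: y = b *: y -> a = b.
Proof.
by move/eqP; rewrite -subr_eq0 -scalerBl scaler_eq0 (negbTE y0) orbF subr_eq0 => /eqP.
Qed.

Let pm k : set V := [set k.+1%:R *: y] `|` [set - k.+1%:R *: y].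

Let mpm k : measurable (pm k).
Proof. by apply: measurableU; exact: measurable_set1_rV. Qed.

Let neq_pm (i j : nat) : i.+1%:R <> - j.+1%:R :> R.
Proof.
move=> h; have : 0 < i.+1%:R + j.+1%:R :> R by rewrite addr_gt0.
by rewrite h addNr ltxx.
Qed.

Let Ppm k : P (pm k) = (2 * lattice_mass k)%:E.
Proof.
have -> : P (pm k) = (P [set k.+1%:R *: y] + P [set - k.+1%:R *: y])%E.
  apply: measureU; [exact: measurable_set1_rV|exact: measurable_set1_rV|].
  by apply/seteqP; split => // x [/= -> /scale_inj /neq_pm].
by rewrite massE massNE -EFinD mulrDl mul1r.
Qed.

(** The pairs of points (k + 1) y and - (k + 1) y are disjoint since y is non-zero, and their union
    contains the support; countable additivity gives total mass 1. *)
Lemma lattice_mass_cvg : \sum_(k < N) 2 * lattice_mass k @[N --> \oo] --> (1 : R).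
Proof.
have mY : measurable (\bigcup_k pm k) by exact: bigcupT_measurable.
have PY : P (\bigcup_k pm k) = 1%E.
  apply: msupp_full => // x /supp_y [[k|k]] /= k0 <-.
    by case: k k0 => // k _; exists k => //; left.
  by exists k => //; right; rewrite NegzE mulrNz.
have tpm : trivIset setT pm.
  move=> i j _ _ [x [[] /= -> [] /= /scale_inj]].
  - by move=> /eqP; rewrite eqr_nat eqSS => /eqP.
  - by move/neq_pm.
  - by move/esym/neq_pm.
  - by move=> /oppr_inj/eqP; rewrite eqr_nat eqSS => /eqP.
have : (\sum_(0 <= i < N) P (pm i))%E @[N --> \oo] --> P (\bigcup_k pm k).
  exact: (@measure_semi_sigma_additive _ _ _ P pm mpm tpm mY).
rewrite PY => /fine_cvgP [_]; apply: cvg_trans; apply: near_eq_cvg.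
near=> N; rewrite /= big_mkord.
transitivity (fine (\sum_(k < N) (2 * lattice_mass k)%:E)%E); last by rewrite sumEFin.
by congr fine; apply: eq_bigr => k _; exact: Ppm.
Unshelve. all: by end_near.
Qed.

Lemma lattice_mass_sum_le1 N : \sum_(k < N) 2 * lattice_mass k <= 1.
Proof.
have nd : nondecreasing_seq (fun N => \sum_(k < N) 2 * lattice_mass k).
  apply/nondecreasing_seqP => m; rewrite big_ord_recr/= lerDl mulr_ge0//.
  exact: lattice_mass_ge0.
rewrite -[leRHS](cvg_lim (@Rhausdorff R) lattice_mass_cvg).
by apply: nondecreasing_cvgn_le => //; apply/cvg_ex; exists 1; exact: lattice_mass_cvg.
Qed.

Definition lattice_residue N : R := 1 - \sum_(k < N) 2 * lattice_mass k.

(* The mass outside the first N pairs of atoms is moved to the atoms +-y. *)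
Definition truncated_mass N k : R :=
  lattice_mass k + (k == 0%N)%:R * (lattice_residue N / 2).

Lemma lattice_residue_ge0 N : 0 <= lattice_residue N.
Proof. by rewrite subr_ge0 lattice_mass_sum_le1. Qed.

Lemma truncated_mass_ge0 N k : 0 <= truncated_mass N k.
Proof.
rewrite addr_ge0 ?lattice_mass_ge0// mulr_ge0// divr_ge0//.
exact: lattice_residue_ge0.
Qed.

Let sum_delta0 N (u : nat -> R) : (0 < N)%N ->
  \sum_(k < N) (nat_of_ord k == 0%N)%:R * u k = u 0%N.
Proof.
case: N => // N _; rewrite big_ord_recl/= mul1r big1 ?addr0// => k _.
by rewrite mul0r.
Qed.

Lemma truncated_mass_sum N : (0 < N)%N -> \sum_(k < N) 2 * truncated_mass N k = 1.
Proof.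
move=> N0; under eq_bigr do rewrite /truncated_mass mulrDr.
rewrite big_split/=; under [X in _ + X]eq_bigr do rewrite mulrCA.
rewrite (sum_delta0 (fun=> 2 * (lattice_residue N / 2)))// /lattice_residue.
by move: (\sum_(_ < _) _) => S; lra.
Qed.

(** The moved mass sits at distance one step from 0, so it enters the second moment with weight
    1. *)
Lemma truncated_moment N : (0 < N)%N ->
  2 * \sum_(k < N) k.+1%:R ^+ 2 * truncated_mass N k =
  2 * \sum_(k < N) k.+1%:R ^+ 2 * lattice_mass k + lattice_residue N.
Proof.
move=> N0; under eq_bigr do rewrite /truncated_mass mulrDr.
rewrite big_split/=; under [X in _ + X]eq_bigr do rewrite mulrCA.
rewrite (sum_delta0 (fun k => k.+1%:R ^+ 2 * (lattice_residue N / 2)))//.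
by rewrite expr1n mul1r; lra.
Qed.

(** One residue is lost by discarding the far atoms, another by putting their mass at y and -y. *)
Lemma truncated_step_approx N (h : V -> R) c : (0 < N)%N ->
  measurable_fun setT h -> (forall x, `|h x| <= c) ->
  `|\int[P]_x h x - symm_step N (truncated_mass N) y h 0| <=
  2 * lattice_residue N * c.
Proof.
move=> N0 mh hc.
pose s := [seq k.+1%:R *: y | k <- index_iota 0 N] ++ [seq - k.+1%:R *: y | k <- index_iota 0 N].
have us : uniq s.
  rewrite cat_uniq !map_inj_uniq ?iota_uniq ?andbT//=.
  - apply/hasPn => x /mapP[j _ ->]; apply/mapP => -[i _ /scale_inj].
    by move/esym/neq_pm.
  - by move=> i j /scale_inj /oppr_inj/eqP; rewrite eqr_nat eqSS => /eqP.
  - by move=> i j /scale_inj/eqP; rewrite eqr_nat eqSS => /eqP.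
have sumE (w : V -> R) : \sum_(v <- s) fine (P [set v]) * w v =
    \sum_(k < N) lattice_mass k * (w (k.+1%:R *: y) + w (- k.+1%:R *: y)).
  rewrite big_cat/= !big_map !big_mkord -big_split/=.
  by apply: eq_bigr => k _; rewrite massNE/= mulrDr.
have := discrete_integral_approx P (@measurable_set1_rV R n) us mh hc.
have -> : \sum_(v <- s) fine (P [set v]) = \sum_(k < N) 2 * lattice_mass k.
  transitivity (\sum_(v <- s) fine (P [set v]) * 1).
    by apply: eq_bigr => v _; rewrite mulr1.
  by rewrite sumE; apply: eq_bigr => k _; rewrite mulrC.
rewrite sumE -/(lattice_residue N) => A.
have -> : symm_step N (truncated_mass N) y h 0 =
    \sum_(k < N) lattice_mass k * (h (k.+1%:R *: y) + h (- k.+1%:R *: y)) +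
    lattice_residue N / 2 * (h y + h (- y)).
  rewrite symm_stepE; under eq_bigr do rewrite add0r sub0r -scaler_nat -scaleNr /truncated_mass mulrDl.
  rewrite big_split/=; congr (_ + _); under eq_bigr do rewrite -mulrA.
  rewrite (sum_delta0 (fun k => lattice_residue N / 2 * (h (k.+1%:R *: y) + h (- k.+1%:R *: y))))//.
  by rewrite scale1r scaleN1r.
rewrite opprD addrA (le_trans (ler_normB _ _))//.
have B : `|lattice_residue N / 2 * (h y + h (- y))| <= lattice_residue N * c.
  rewrite normrM ger0_norm ?divr_ge0 ?lattice_residue_ge0//.
  rewrite -mulrA ler_wpM2l ?lattice_residue_ge0//.
  have := ler_normD (h y) (h (- y)); have := hc y; have := hc (- y); lra.
move: A B; move: `|_| `|_| => u v; lra.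
Qed.

Lemma lattice_sigma_moment_le (s : R) N : 0 <= s -> lattice_sigma P y = s%:E ->
  2 * \sum_(k < N) k.+1%:R ^+ 2 * lattice_mass k <= s ^+ 2.
Proof.
move=> s0; rewrite /lattice_sigma => sE.
have t0 k : (0 <= (k%:R ^+ 2 : R)%:E * P [set (k%:R *: y)])%E.
  by rewrite mule_ge0// lee_fin sqr_ge0.
have S0 : (0 <= \sum_(1 <= k <oo) ((k%:R ^+ 2)%:E * P [set (k%:R *: y)%R]))%E.
  by apply: nneseries_ge0 => k _ _.
have : (2%:E * \sum_(1 <= k <oo) ((k%:R ^+ 2)%:E * P [set (k%:R *: y)%R]) = (s ^+ 2)%:E)%E.
  rewrite -[LHS]sqr_sqrte; last by rewrite mule_ge0// lee_fin.
  by rewrite sE -EFin_expe.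
have := @nneseries_lim_ge R (fun k => (k%:R ^+ 2)%:E * P [set (k%:R *: y)%R])%E xpredT 1 N.+1 (fun k _ _ => t0 k).
rewrite big_add1/= big_mkord => L E.
rewrite -lee_fin -E EFinM lee_wpmul2l// ?lee_fin//.
apply: le_trans L; rewrite -sumEFin le_eqVlt; apply/orP; left; apply/eqP.
by apply: eq_bigr => k _; rewrite EFinM; congr (_ * _)%E; exact: esym (massE k).
Qed.

End lattice_law.

(** * Scalar comparison of the exponential with binomial powers *)

Section exponential.
Variable R : realType.
Implicit Types x : R.

Lemma exp_partial_sum_le x J : 0 <= x -> \sum_(j < J) x ^+ j / j`!%:R <= expR x.
Proof.
move=> x0; have -> : \sum_(j < J) x ^+ j / j`!%:R = series (exp_coeff x) J.
  by rewrite /series/= big_mkord.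
apply: nondecreasing_cvgn_le; last exact: is_cvg_series_exp_coeff.
apply/nondecreasing_seqP => m; rewrite /series/= !big_mkord big_ord_recr/= lerDl.
by rewrite divr_ge0// exprn_ge0.
Qed.

Lemma ffact_le_exp m j : (m ^_ j <= m ^ j)%N.
Proof.
by elim: j => // j IH; rewrite ffactnSr expnSr leq_mul// leq_subr.
Qed.

(** j! C(m, j) is a falling factorial, at most m^j <= (s n)^j. *)
Lemma bin_div_expn_le m s j (n : nat) : (0 < s)%N -> (m <= s * n)%N ->
  'C(m, j)%:R / s%:R ^+ j <= n%:R ^+ j / j`!%:R :> R.
Proof.
move=> s0 msn; rewrite ler_pdivrMr ?exprn_gt0 ?ltr0n// mulrAC.
rewrite ler_pdivlMr ?ltr0n ?fact_gt0// -!natrX -!natrM ler_nat bin_ffact -expnMn.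
rewrite (leq_trans (ffact_le_exp _ _))//.
by case: j => [|j]; rewrite ?expn0// leq_exp2r// mulnC.
Qed.

(* By 1 + x >= exp (x / (1 + x)) at x = 2 / s. *)
Lemma exp_sub_compound_le (n : nat) (eta : R) : 0 < eta ->
  exists2 s : nat, (0 < s)%N &
    expR (2 * n%:R) - (1 + 2 / s%:R) ^+ (s * n) <= eta.
Proof.
(* The difference will be at most exp (2 n) * 4 n / s, which is at most eta once s >= c. *)
move=> eta0; pose c := expR (2 * n%:R : R) * (4 * n%:R) / eta.
have c0 : 0 <= c by rewrite divr_ge0 ?mulr_ge0 ?expR_ge0 ?(ltW eta0).
pose s := (Num.bound c).+1.
have sc : c <= s%:R.
  by rewrite (le_trans (ltW (archi_boundP c0)))// ler_nat.
have s0 : 0 < s%:R :> R by rewrite ltr0n.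
exists s => //.
pose x : R := 2 / s%:R.
have x0 : 0 < x by rewrite divr_gt0.
have x1 : 0 < 1 + x by lra.
have low : expR (x / (1 + x)) <= 1 + x.
  have := expR_ge1Dx (- (x / (1 + x))); rewrite expRN.
  have -> : 1 + - (x / (1 + x)) = (1 + x)^-1 by field; exact: lt0r_neq0.
  by rewrite lef_pV2// posrE expR_gt0.
have : expR (2 * n%:R - 4 * n%:R / s%:R) <= (1 + x) ^+ (s * n).
  apply: (@le_trans _ _ (expR (x / (1 + x)) ^+ (s * n))); last first.
    by rewrite lerXn2r// nnegrE ?expR_ge0// ltW.
  rewrite -expRM_natr ler_expR natrM.
  rewrite -subr_ge0 (_ : _ - _ = 8 * n%:R / (s%:R * (s%:R + 2))).
    by rewrite divr_ge0 ?mulr_ge0// addr_ge0.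
  rewrite /x; field; rewrite !lt0r_neq0 ?addr_gt0//.
rewrite expRD => h.
have h2 := expR_ge1Dx (- (4 * n%:R / s%:R) : R).
have h3 : expR (2 * n%:R) * (4 * n%:R / s%:R) <= eta.
  by rewrite mulrA ler_pdivrMr// [leRHS]mulrC -ler_pdivrMr.
have h4 := ler_wpM2l (expR_ge0 (2 * n%:R)) h2.
rewrite mulrDr mulr1 mulrN in h4.
move: h h4 h3; rewrite -/x; lra.
Qed.

End exponential.

(** * The operator exponential as a limit of binomial powers *)

Section compound_limit.
Variables (R : realType) (V : zmodType).
Notation sc := (@convop_scalar R V).
Implicit Types T : convop R V.

(* The coefficients of the exponential series dominate those of the binomial one,
   so the difference is largest when T - 1 is replaced by its norm bound 2. *)
Lemma exp_convop_approx T (h : V -> R) (n s J : nat) x : op_bound T 1 ->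
  (forall z, `|h z| <= 1) -> (0 < s)%N -> (s * n < J)%N ->
  `|\sum_(j < J) ((sc n%:R * T - sc n%:R) ^+ j) h x / j`!%:R -
    ((1 + sc s%:R^-1 * (T - 1)) ^+ (s * n)) h x| <=
  expR (2 * n%:R) - (1 + 2 / s%:R) ^+ (s * n).
Proof.
move=> T1 h1 s0 snJ; set m := (s * n)%N.
pose c j := ((T - 1) ^+ j) h x.
have c2 j : `|c j| <= 2 ^+ j.
  have := op_boundX j (op_boundD T1 (op_boundN (@op_bound1 R V))).
  by move=> /(_ h 1 h1 x); rewrite mulr1.
have E1 j : ((sc n%:R * T - sc n%:R) ^+ j) h x = n%:R ^+ j * c j.
  have -> : sc n%:R * T - sc n%:R = sc n%:R * (T - 1) by ring.
  by rewrite exprMn -rmorphXn convop_mulE.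
(* Both binomial sums are extended to J terms, where the coefficients above m vanish, for comparison
   with the exponential sum term by term. *)
have E2 : ((1 + sc s%:R^-1 * (T - 1)) ^+ m) h x =
    \sum_(j < J) 'C(m, j)%:R / s%:R ^+ j * c j.
  rewrite exprDn convop_sumE.
  rewrite (big_ord_widen J (fun j => (1 ^+ (m - j) * (sc s%:R^-1 * (T - 1)) ^+ j *+ 'C(m, j)) h x))//.
  rewrite big_mkcond/=; apply: eq_bigr => j _.
  rewrite ltnS; case: leqP => jm; last by rewrite bin_small// !mul0r.
  rewrite expr1n mul1r exprMn -rmorphXn -mulrnAl -rmorphMn convop_mulE convop_scalarE.
  by rewrite -[_ *+ _]mulr_natl exprVn.
have E3 : (1 + 2 / s%:R) ^+ m = \sum_(j < J) 'C(m, j)%:R / s%:R ^+ j * 2 ^+ j :> R.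
  rewrite exprDn.
  rewrite (big_ord_widen J (fun j => 1 ^+ (m - j) * (2 / s%:R) ^+ j *+ 'C(m, j) : R))//.
  rewrite big_mkcond/=; apply: eq_bigr => j _.
  rewrite ltnS; case: leqP => jm; last by rewrite bin_small// !mul0r.
  by rewrite expr1n mul1r expr_div_n -mulr_natl; ring.
rewrite E2 E3 -sumrB.
have e1 := @exp_partial_sum_le R (2 * n%:R) J (mulr_ge0 (ler0n _ _) (ler0n _ _)).
apply: le_trans (lerB e1 (lexx _)).
rewrite -sumrB (le_trans (ler_norm_sum _ _ _))//; apply: ler_sum => j _.
rewrite E1 mulrAC -mulrBl normrM.
have d0 : 0 <= n%:R ^+ j / j`!%:R - 'C(m, j)%:R / s%:R ^+ j :> R.
  by rewrite subr_ge0 bin_div_expn_le.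
rewrite (ger0_norm d0) (le_trans (ler_wpM2l d0 (c2 j)))// mulrBl exprMn.
by rewrite le_eqVlt; apply/orP; left; apply/eqP; ring.
Qed.

End compound_limit.

(** * The estimate for general lattice mixtures on one Borel set *)

Section lattice_mixture.
Variables (R : realType).

Variable C : R.
Hypothesis C0 : 0 < C.
Hypothesis smoothingC : smoothing_constant C.

Variables (d K : nat) (F : probability 'rV[R]_d R) (q : R) (p : 'I_K -> R).
Variables (Fm : 'I_K -> probability 'rV[R]_d R) (y : 'I_K -> 'rV[R]_d).
Hypothesis q01 : 0 < q < 1.
Hypothesis p0 : forall m, 0 < p m.
Hypothesis pq : \sum_(m < K) p m = 1 - q.
Hypothesis FE : forall B, measurable B ->
  F B = (q%:E * \d_(0%R : 'rV[R]_d) B + \sum_(m < K) (p m)%:E * Fm m B)%E.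
Hypothesis y0 : forall m, y m != 0.
Hypothesis supp_y : forall m,
  msupp (Fm m) `<=` [set k%:~R *: y m | k in [set k : int | k != 0]].
Hypothesis sym_y : forall m (k : nat), (0 < k)%N ->
  Fm m [set k%:R *: y m] = Fm m [set - k%:R *: y m].
Variable s : 'I_K -> R.
Hypothesis s0 : forall m, 0 <= s m.
Hypothesis sE : forall m, lattice_sigma (Fm m) (y m) = (s m)%:E.

Let f N m := truncated_mass (Fm m) (y m) N.
Let T N := mixed_walk N (f N) y q p.

Let f_ge0 N m k : 0 <= f N m k.
Proof. exact: (truncated_mass_ge0 (y0 m) (@supp_y m) (@sym_y m)). Qed.

Let f_sum N m : (0 < N)%N -> \sum_(k < N) 2 * f N m k = 1.
Proof. exact: truncated_mass_sum. Qed.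

Let T_bound N : (0 < N)%N -> op_bound (T N) 1.
Proof.
move=> N0; apply: op_bound_mixed_walk => //.
- by move=> m; exact: f_sum.
- by case/andP: q01 => /ltW.
- by move=> m; exact: ltW.
Qed.

Lemma mixture_step_approx (eps : R) : 0 < eps -> exists2 N, (0 < N)%N &
  forall (h : 'rV[R]_d -> R) (c : R), measurable_fun setT h -> (forall x, `|h x| <= c) ->
    `|\int[F]_x h x - T N h 0| <= eps * c.
Proof.
move=> eps0.
have /choice[N0 N0P] : forall m, exists N0, forall N, (N0 <= N)%N ->
    2 * lattice_residue (Fm m) (y m) N <= eps.
  move=> m; have e20 : 0 < eps / 2 by rewrite divr_gt0.
  have := lattice_mass_cvg (y0 m) (@supp_y m) (@sym_y m).
  move=> /cvgrPdist_le/(_ _ e20)[N0 _ H]; exists N0 => N /H /=.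
  by rewrite /lattice_residue => h; have := le_trans (ler_norm _) h; lra.
pose N := (\max_m N0 m).+1.
exists N => // h c mh hc.
have c0 : 0 <= c by apply: le_trans (hc 0).
rewrite (Rintegral_probability_mixture _ _ FE mh hc); last 2 first.
- by case/andP: q01 => /ltW.
- by move=> m; exact: ltW.
rewrite /T mixed_walkE opprD addrACA subrr add0r -sumrB.
apply: (@le_trans _ _ (\sum_m p m * (eps * c))).
  rewrite (le_trans (ler_norm_sum _ _ _))//; apply: ler_sum => m _.
  rewrite -mulrBr normrM (ger0_norm (ltW (p0 m))) ler_wpM2l ?(ltW (p0 m))//.
  rewrite (le_trans (truncated_step_approx (y0 m) (@supp_y m) (@sym_y m) _ mh hc))//.
  by rewrite ler_wpM2r// N0P// /N leqW// leq_bigmax.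
rewrite -mulr_suml pq ler_piMl ?mulr_ge0 ?(ltW eps0)//.
by case/andP: q01; lra.
Qed.

Let W := \sum_m Num.sqrt (2 * C * (1 + s m) / q ^+ 3).

(** Truncation raises the second moment by at most 1, and s^2 + 1 <= (1 + s)^2, so 1 + sigma becomes
    at most 2 (1 + s). Hence the 2 C in [W], uniformly in N. *)
Let sigma_trunc N m : (0 < N)%N ->
  C * (1 + Num.sqrt (2 * \sum_(k < N) k.+1%:R ^+ 2 * f N m k)) / q ^+ 3 <=
  Num.sqrt (2 * C * (1 + s m) / q ^+ 3) ^+ 2.
Proof.
move=> N0; have q0 : 0 < q by case/andP: q01.
rewrite sqr_sqrtr; last first.
  by rewrite divr_ge0 ?exprn_ge0 ?(ltW q0)// !mulr_ge0 ?(ltW C0)// addr_ge0.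
rewrite ler_pM2r ?invr_gt0 ?exprn_gt0// [2 * C]mulrC -mulrA ler_pM2l//.
suff : Num.sqrt (2 * \sum_(k < N) k.+1%:R ^+ 2 * f N m k) <= 1 + s m.
  by have := s0 m; lra.
have s1 : 0 <= 1 + s m by rewrite addr_ge0.
rewrite -[leRHS]ger0_norm// -sqrtr_sqr ler_wsqrtr//.
rewrite truncated_moment//.
have := lattice_sigma_moment_le N (s0 m) (sE m).
have : lattice_residue (Fm m) (y m) N <= 1.
  rewrite /lattice_residue gerBl; apply: sumr_ge0 => k _.
  by rewrite mulr_ge0// lattice_mass_ge0.
have := s0 m.
move: (2 * _) (lattice_residue _ _ _) (s m) => u v w w0 v1 u1.
have -> : (1 + w) ^+ 2 = 1 + 2 * w + w ^+ 2 by ring.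
lra.
Qed.

Variable n : nat.
Hypothesis n0 : (0 < n)%N.

Let Fc : {charge set 'rV[R]_d -> \bar R} := charge_of_finite_measure F.
Let M : {charge set 'rV[R]_d -> \bar R} := cscale n%:R (cadd (charge_of_finite_measure F) (copp (charge_delta0 R d))).
Variable B : set 'rV[R]_d.
Hypothesis mB : measurable B.

Let B0 : [set x | B (x + 0)] = B.
Proof. by apply/funext => x /=; rewrite addr0. Qed.

Let xi j : R := fine (charge_conv_pow M j B).

Let ME A : measurable A ->
  M A = (n%:R%:E * F A - n%:R%:E * \d_(0%R : 'rV[R]_d) A)%E.
Proof.
move=> mA; have H := fin_num_measure F A mA.
transitivity (n%:R%:E * (F A + - \d_(0%R : 'rV[R]_d) A))%E; first by [].
by rewrite diracE -(fineK H) -EFinN -EFinD -!EFinM -EFinB mulrBr.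
Qed.

Let FcE A : measurable A ->
  Fc A = (1%:E * F A - 0%:E * \d_(0%R : 'rV[R]_d) A)%E.
Proof. by move=> mA; rewrite mul1e mul0e sube0. Qed.

Let xi_bound j : `|xi j| <= (2 * n%:R) ^+ j.
Proof.
have [N N0 TN] := mixture_step_approx ltr01.
have n0' : 0 <= n%:R :> R by [].
have := @charge_conv_pow_approx R d F M _ _ n0' n0' ME (T N) 1 TN (T_bound N0) B j 0 mB.
by rewrite B0 => -[]; rewrite mulrDl mul1r.
Qed.

Let exp_cvg : cvgn (series (fun j => j`!%:R^-1 * xi j)).
Proof.
apply: normed_cvg.
apply: (@series_le_cvg _ _ (exp_coeff (2 * n%:R))) => [j|j|j|].
- exact: normr_ge0.
- by rewrite /exp_coeff/= divr_ge0// exprn_ge0// mulr_ge0.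
- rewrite /exp_coeff/= normrM mulrC [`|_^-1|]ger0_norm ?invr_ge0//; exact: ler_wpM2r.
- exact: is_cvg_series_exp_coeff.
Qed.

Let E := limn (series (fun j => j`!%:R^-1 * xi j)).

Lemma charge_conv_exp_series : charge_conv_exp M B = E%:E.
Proof.
rewrite /charge_conv_exp -EFin_lim; last exact: exp_cvg.
congr (lim (_ @ \oo)%classic); apply/funext => J.
rewrite /= /series/= -sumEFin; apply: eq_bigr => j _.
by rewrite EFinM fineK// fin_num_measure.
Qed.

(** The main term compares the n-th power of [T N] with its compound Poisson approximation. Each eta
    pays for one replacement: F by [T N] in the power, the exponential sum of [T N] by a binomial
    power, and n (F - I) by its operator in the series. *)
Let key eta : 0 < eta ->
  `|fine (charge_conv_pow Fc n B) - E| <= 16 * W ^+ 2 / n%:R + 3 * eta.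
Proof.
move=> eta0.
have n0' : 0 <= n%:R :> R by [].
have [t t0 tP] := exp_sub_compound_le n eta0.
(* The n in the denominator serves the n-th power, exp (4 n) the errors summed over the exponential
   series. *)
pose eps := eta / (n%:R + expR (4 * n%:R)).
have den0 : 0 < n%:R + expR (4 * n%:R) :> R by rewrite ltr_wpDl// expR_gt0.
have eps0 : 0 < eps by rewrite divr_gt0.
have [N N0 TN] := mixture_step_approx eps0.
pose h : 'rV[R]_d -> R := \1_B.
have h1 z : `|h z| <= 1.
  by rewrite /h indicE; case: (_ \in _); rewrite ?normr1 ?normr0.
have A1 : `|fine (charge_conv_pow Fc n B) - ((T N) ^+ n) h 0| <= eta.
  have := @charge_conv_pow_approx R d F Fc _ _ ler01 (lexx 0) FcE (T N) eps TN (T_bound N0) B n 0 mB.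
  rewrite B0 addr0 expr1n mulr1 rmorph1 mul1r rmorph0 subr0 => -[_] /le_trans; apply.
  rewrite /eps mulrA ler_pdivrMr// mulrC ler_wpM2l ?(ltW eta0)//.
  by rewrite lerDl expR_ge0.
have A2 : `|((T N) ^+ n) h 0 - ((1 + convop_scalar _ t%:R^-1 * (T N - 1)) ^+ (t * n)) h 0|
    <= 16 * W ^+ 2 / n%:R.
  have := @finite_walk_compound_poisson R _ C C0 smoothingC K N (f N) y (f_ge0 N)
    (fun m => f_sum m N0) q p (fun m => Num.sqrt (2 * C * (1 + s m) / q ^+ 3)) n t
    q01 p0 pq (fun m => sqrtr_ge0 _) (fun m => sigma_trunc m N0) n0 t0.
  by move=> /(_ h 1 h1 0); rewrite convop_addE convop_oppE mulr1.
have cvgE : `|fine (charge_conv_pow Fc n B) - series (fun j => j`!%:R^-1 * xi j) J|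
    @[J --> \oo] --> `|fine (charge_conv_pow Fc n B) - E|.
  by apply: cvg_norm; apply: cvgB; [exact: cvg_cst|exact: exp_cvg].
rewrite -(cvg_lim (@Rhausdorff R) cvgE); apply: limr_le; first exact: cvgP cvgE.
near=> J.
have tJ : (t * n < J)%N by near: J; exists (t * n).+1.
have A3 := exp_convop_approx 0 (T_bound N0) h1 t0 tJ.
have A4 : `|series (fun j => j`!%:R^-1 * xi j) J -
    \sum_(j < J) ((convop_scalar _ n%:R * T N - convop_scalar _ n%:R) ^+ j) h 0 / j`!%:R| <= eta.
  rewrite /series/= big_mkord -sumrB.
  apply: (@le_trans _ _ (\sum_(j < J) (4 * n%:R) ^+ j / j`!%:R * eps)).
    rewrite (le_trans (ler_norm_sum _ _ _))//; apply: ler_sum => j _.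
    rewrite mulrC -mulrBl normrM [`|_^-1|]ger0_norm ?invr_ge0// mulrAC ler_wpM2r ?invr_ge0//.
    have := @charge_conv_pow_approx R d F M _ _ n0' n0' ME (T N) eps TN (T_bound N0) B j 0 mB.
    rewrite B0 => -[_] /le_trans; apply; rewrite ler_wpM2r ?(ltW eps0)//.
    (* The factor j in the error of the j-th power is absorbed by 2^j. *)
    have -> : 4 * n%:R = 2 * (n%:R + n%:R) :> R by ring.
    rewrite exprMn ler_wpM2r ?exprn_ge0 ?addr_ge0//.
    by rewrite -natrX ler_nat ltnW// ltn_expl.
  rewrite -mulr_suml (le_trans (ler_wpM2r (ltW eps0) (exp_partial_sum_le J _)))//.
  rewrite /eps mulrCA ler_piMr ?(ltW eta0)// ler_pdivrMr// mul1r.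
  by rewrite lerDr.
rewrite /=.
move: A1 A2 A3 A4 tP.
move: (fine _) (_ h 0) (_ h 0) (\sum_(_ < _) _) (series _ J) (expR _ - _) (16 * _ / _) => a b c e g k l.
rewrite !ler_norml => /andP[? ?] /andP[? ?] /andP[? ?] /andP[? ?] ?.
by apply/andP; split; lra.
Unshelve. all: by end_near.
Qed.

(** Let eta tend to 0 in [key]; [W] squared contributes 2 C / q^3, which makes 32 C out of the
    16. *)
Lemma lattice_mixture_bound :
  (`|charge_conv_pow Fc n B - charge_conv_exp M B| <=
   (32 * C / (n%:R * q ^+ 3) * (\sum_m Num.sqrt (1 + s m)) ^+ 2)%:E)%E.
Proof.
have q0 : 0 < q by case/andP: q01.
have n0' : 0 < n%:R :> R by rewrite ltr0n.
have -> : charge_conv_pow Fc n B = (fine (charge_conv_pow Fc n B))%:E.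
  by rewrite fineK// fin_num_measure.
rewrite charge_conv_exp_series -EFinB abse_EFin lee_fin.
have -> : 32 * C / (n%:R * q ^+ 3) * (\sum_m Num.sqrt (1 + s m)) ^+ 2 = 16 * W ^+ 2 / n%:R.
  have -> : W = Num.sqrt (2 * C / q ^+ 3) * \sum_m Num.sqrt (1 + s m).
    rewrite /W mulr_sumr; apply: eq_bigr => m _; rewrite -sqrtrM.
      by congr Num.sqrt; ring.
    by rewrite divr_ge0 ?exprn_ge0 ?(ltW q0)// mulr_ge0// ltW.
  rewrite exprMn sqr_sqrtr; last by rewrite divr_ge0 ?exprn_ge0 ?(ltW q0)// mulr_ge0// ltW.
  by field; rewrite !lt0r_neq0.
apply/ler_addgt0Pr => e e0.
have e30 : 0 < e / 3 by rewrite divr_gt0.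
rewrite (le_trans (key e30))// lerD2l le_eqVlt; apply/orP; left; apply/eqP; lra.
Qed.

End lattice_mixture.

(** * Supremum over Borel sets, with infinite variances allowed *)

Theorem mainTheorem6 (R : realType) :
  exists2 C : R, 0 < C &
  forall (d K : nat) (F : probability 'rV[R]_d R)
    (q : R) (p : 'I_K -> R) (Fm : 'I_K -> probability 'rV[R]_d R)
    (y : 'I_K -> 'rV[R]_d),
  (0 < d)%N -> (d <= K)%N ->
  0 < q < 1 -> (forall m, 0 < p m < 1) -> \sum_(m < K) p m = 1 - q ->
  (forall B, measurable B ->
    F B = (q%:E * \d_(0%R : 'rV[R]_d) B + \sum_(m < K) (p m)%:E * Fm m B)%E) ->
  (forall m, y m != 0) ->
  (forall m, msupp (Fm m) `<=` [set k%:~R *: y m | k in [set k : int | k != 0]]) ->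
  (forall m k, k != m -> msupp (Fm m) `&` msupp (Fm k) = set0) ->
  (forall m, msupp (Fm m) !=set0) ->
  (forall m (k : nat), (0 < k)%N ->
    Fm m [set k%:R *: y m] = Fm m [set - k%:R *: y m]) ->
  (forall m, exists k0 : int,
    (0 < Fm m [set k0%:~R *: y m])%E /\
    (0 < Fm m [set (k0 + 1)%:~R *: y m])%E) ->
  forall n : nat, (0 < n)%N ->
  (d_TV (charge_conv_pow (charge_of_finite_measure F) n)
        (charge_conv_exp (cscale n%:R
          (cadd (charge_of_finite_measure F) (copp (charge_delta0 R d)))))
   <= (C / (n%:R * q `^ (7 / 2)))%:E
      * (\sum_(m < K) sqrte (1 + lattice_sigma (Fm m) (y m))) ^+ 2)%E.
Proof.
have [C C0 smoothingC] := smoothing_constant_exists R.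
exists (32 * C); first by rewrite mulr_gt0.
move=> d K F q p Fm y d0 dK q01 p01 pq FE y0 supp_y _ _ sym_y _ n n0.
have q0 : 0 < q by case/andP: q01.
have p0 m : 0 < p m by case/andP: (p01 m).
have q1 : q <= 1 by case/andP: q01 => _ /ltW.
have n0' : 0 < n%:R :> R by rewrite ltr0n.
have const0 : 0 < 32 * C / (n%:R * q `^ (7 / 2)).
  by rewrite divr_gt0 ?mulr_gt0 ?powR_gt0.
have sigma0 m : (0 <= lattice_sigma (Fm m) (y m))%E by exact: sqrte_ge0.
(* If some sigma is infinite, the right-hand side is infinite, because the constant in front is
   positive. *)
have [/forallP fin_sigma|] :=
    boolP [forall m, lattice_sigma (Fm m) (y m) \is a fin_num]; last first.
  rewrite negb_forall => /existsP[m0 infm].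
  have -> : (\sum_(m < K) sqrte (1 + lattice_sigma (Fm m) (y m)) = +oo)%E.
    apply/esum_eqyP; first by move=> i _; rewrite gt_eqF// (lt_le_trans ltNy0)// sqrte_ge0.
    exists m0; split => //.
    by move: infm (sigma0 m0); case: (lattice_sigma _ _).
  by rewrite expe2 mulyy gt0_muley ?lte_fin// leey.
pose s m := fine (lattice_sigma (Fm m) (y m)).
have sE m : lattice_sigma (Fm m) (y m) = (s m)%:E by rewrite fineK.
have s0 m : 0 <= s m by rewrite fine_ge0.
have -> : (\sum_(m < K) sqrte (1 + lattice_sigma (Fm m) (y m)) =
    (\sum_(m < K) Num.sqrt (1 + s m))%:E)%E.
  by rewrite -sumEFin; apply: eq_bigr => m _; rewrite sE.
apply: ge_ereal_sup => _ [B mB <-].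
apply: le_trans (lattice_mixture_bound C0 smoothingC q01 p0 pq FE y0 supp_y sym_y s0 sE n0 mB) _.
rewrite -EFin_expe -EFinM lee_fin ler_wpM2r ?sqr_ge0//.
rewrite ler_wpM2l ?mulr_ge0 ?(ltW C0)// lef_pV2 ?posrE ?mulr_gt0 ?powR_gt0 ?exprn_gt0//.
rewrite ler_pM2l// -powR_mulrn ?(ltW q0)// ger_powR ?q0//.
by rewrite ler_pdivlMr// -natrM ler_nat.
Qed.
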